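(* Let $E\subset\mathbb R^2$ be compact with $\dim_{\mathcal H}(E)>7/4$. Then the set $$\left\{\left(\tfrac12\left|\det[x-w,\,y-w]\right|,\ \tfrac12\left|\det[y-w,\,z-w]\right|\right) : x,y,z,w\in E\right\}$$ has nonempty interior in $\mathbb R^2$.
   Context: $\dim_{\mathcal H}$ denotes Hausdorff dimension; $\det[u,v]$ is the determinant of the $2\times2$ matrix with columns $u,v\in\mathbb R^2$. *)

(* Defs.v *)
From HB Require Import structures.
From mathcomp Require Import all_boot all_order all_algebra.
From mathcomp Require Import all_classical all_reals all_analysis.
Set Implicit Arguments. Unset Strict Implicit. Unset Printing Implicit Defensive.
Import Order.TTheory GRing.Theory Num.Theory.
Import numFieldTopology.Exports numFieldNormedType.Exports.
Local Open Scope classical_set_scope.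
Local Open Scope ring_scope.

Section Defs.
Variable R : realType.

Definition edist (p q : R * R) : R :=
  Num.sqrt ((p.1 - q.1) ^+ 2 + (p.2 - q.2) ^+ 2).

(* diameter (in \bar R; -oo for the empty set) *)
Definition diam (U : set (R * R)) : \bar R :=
  ereal_sup [set (edist pq.1 pq.2)%:E | pq in U `*` U].

(* delta-approximate s-dimensional Hausdorff measure:
   inf over countable covers by sets of diameter <= delta of sum diam(U_i)^s
   (empty sets contribute 0 since fine (-oo) = 0 and 0 `^ s = 0 for s > 0) *)
Definition hausdorff_delta (s delta : R) (E : set (R * R)) : \bar R :=
  ereal_inf [set (\sum_(0 <= i <oo) ((fine (diam (U i))) `^ s)%:E)%E
            | U in [set U : nat -> set (R * R) |
                     (forall i, (diam (U i) <= delta%:E)%E) /\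
                     E `<=` \bigcup_i U i]].

Definition hausdorff_measure (s : R) (E : set (R * R)) : \bar R :=
  ereal_sup [set hausdorff_delta s delta E | delta in [set d : R | 0 < d]].

Definition hausdorff_dim (E : set (R * R)) : \bar R :=
  ereal_inf [set s%:E | s in [set s : R | 0 < s /\ hausdorff_measure s E = 0%E]].

Definition det2 (u v : R * R) : R := u.1 * v.2 - u.2 * v.1.

Definition vsub (u v : R * R) : R * R := (u.1 - v.1, u.2 - v.2).

Definition area_pairs (E : set (R * R)) : set (R * R) :=
  [set p | exists x y z w, [/\ E x, E y, E z, E w &
     p = (2^-1 * `|det2 (vsub x w) (vsub y w)|,
          2^-1 * `|det2 (vsub y w) (vsub z w)|)]].

End Defs.

(* Main.v *)
Require Import Defs.
From HB Require Import structures.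
From mathcomp Require Import all_boot all_order all_algebra.
From mathcomp Require Import all_classical all_reals.
From mathcomp Require Import ring lra zify.
Set Implicit Arguments.
Unset Strict Implicit.
Unset Printing Implicit Defensive.
Import Order.TTheory GRing.Theory Num.Theory.
Local Open Scope ring_scope.

(* Fix w in E and translate it to the origin. For X, Y, Z in E - w, the relevant
   pair is (X ^ Y, Y ^ Z), where ^ is det2, so up to a sign it is enough that the pairs
   (X ^ Y, Z ^ Y) fill a ball around some (s0, s0) with s0 <> 0; as E is compact,
   it is enough that they are dense there. Let mu be a Frostman measure of
   exponent 7/4 on E - w (here: finitely supported, with bounds uniform down to a
   scale tending to 0), and let H_P(s, Y) be the density at s of X ^ Y, X
   distributed by mu, smoothed at scale 1/P. The squares of the differences
   H_256P - H_P, integrated over Y in the plane, have a pair kernel in X, X' which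
   by cancellation is O(1 / (P |X - X'|^2)); its energy is O(P^(-3/4)). Since mu
   has density at most h^(-1/4) at scale h, the differences decay geometrically
   in L^2(mu), so that H_P(s, .) stays close in L^2(mu) to H_P0(s0, .) for all P
   and all s near s0. Hence the integral of H_P(s, Y) H_P(t, Y) is positive, which
   provides X, Y, Z with X ^ Y and Z ^ Y within O(1/P) of s and t. The point s0
   is chosen in a finite grid, hence can be fixed along a subsequence. *)

(** * Tent functions *)

(** Dividing by Y1 turns X ^ Y = s into c = X1 m - X2 with m = Y2 / Y1 and c = s / Y1: X becomes a
    line in the (m, c) plane, Y a point, and the kernel of two lines is an integral over m and c.
    Sliding c along the first line leaves an integral in m of a function of t + m u, where u = X'1 -
    X1. The two bumps in a difference have the same mass, so only the variation of a Lipschitz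
    cutoff over a length 1 / (P |u|) survives: this gives 1 / (P u^2). The divisions force Y1 and s
    to stay away from 0. The obstacle is to pass from L^2 of the plane to L^2(mu), by averaging over
    squares of side H. A difference has Lipschitz constant O(P^2), so P^2 H must decay, while the
    density H^(-1/4) must not eat up the energy P^(-3/4). With P = 16^(b k) and H = 16^(-a k) this
    reads 2 b < a < 3 b; the least integers are b = 2 and a = 5, hence the 256 and the factors 5.
    Integrals are Riemann sums over a grid whose mesh is chosen last, so fine that its errors are
    harmless. *)

Section Tent.
Variable R : realType.
Implicit Types (x y a e t u P : R).

Definition hinge x : R := Num.max 0 x.

Lemma hingeP x : (0 <= x /\ hinge x = x) \/ (x <= 0 /\ hinge x = 0).
Proof. by rewrite /hinge; case: (leP 0 x) => h; [left | right; split=> //; exact: ltW]. Qed.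

(** The hat function as a second difference of [hinge], so that estimates reduce to a case split on
    three signs and arithmetic; [tent_prim] is its antiderivative, rising from 0 to 1. *)
Definition tent x := hinge (x + 1) - 2 * hinge x + hinge (x - 1).
Definition tent_prim x := (hinge (x + 1) ^+ 2 - 2 * hinge x ^+ 2 + hinge (x - 1) ^+ 2) / 2.

Ltac hinge_cases x := case: (hingeP (x + 1)) => -[? ->]; case: (hingeP x) => -[? ->]; case: (hingeP (x - 1)) => -[? ->].

Lemma tent_bound x : 0 <= tent x <= 1.
Proof. by rewrite /tent; hinge_cases x; apply/andP; split; lra. Qed.

Lemma tent_out x : 1 <= `|x| -> tent x = 0.
Proof. by rewrite ler_normr => /orP[] h; rewrite /tent; hinge_cases x; lra. Qed.

Lemma tent_half x : `|x| <= 2^-1 -> 2^-1 <= tent x.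
Proof. by rewrite ler_norml => /andP[h1 h2]; rewrite /tent; hinge_cases x; lra. Qed.

Lemma tentN x : tent (- x) = tent x.
Proof.
rewrite /tent; case: (hingeP (- x + 1)) => -[? ->]; case: (hingeP (- x)) => -[? ->];
 case: (hingeP (- x - 1)) => -[? ->]; hinge_cases x; lra.
Qed.

Lemma hinge_lip x y : `|hinge x - hinge y| <= `|x - y|.
Proof.
by rewrite ler_norml; case: (hingeP x) => -[? ->]; case: (hingeP y) => -[? ->];
  case: (ger0P (x - y)) => h; apply/andP; split; lra.
Qed.

Lemma tent_lip x y : `|tent x - tent y| <= 4 * `|x - y|.
Proof.
have h1 := hinge_lip (x + 1) (y + 1); have h2 := hinge_lip x y.
have h3 := hinge_lip (x - 1) (y - 1).
have e1 : x + 1 - (y + 1) = x - y by ring.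
have e3 : x - 1 - (y - 1) = x - y by ring.
move: h1 h2 h3; rewrite e1 e3 /tent !ler_norml.
by move=> /andP[? ?] /andP[? ?] /andP[? ?]; apply/andP; split; lra.
Qed.

Lemma tent_prim_lo x : x <= -1 -> tent_prim x = 0.
Proof. by move=> h; rewrite /tent_prim; hinge_cases x; nra. Qed.

Lemma tent_prim_hi x : 1 <= x -> tent_prim x = 1.
Proof. by move=> h; rewrite /tent_prim; hinge_cases x; nra. Qed.

Lemma tent_prim_bound x : 0 <= tent_prim x <= 1.
Proof. by rewrite /tent_prim; hinge_cases x; apply/andP; split; nra. Qed.

Lemma hinge_taylor x e : 0 <= hinge (x + e) ^+ 2 - hinge x ^+ 2 - 2 * e * hinge x <= e ^+ 2.
Proof. by case: (hingeP (x + e)) => -[? ->]; case: (hingeP x) => -[? ->]; apply/andP; split; nra. Qed.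

Lemma tent_prim_taylor x e : `|e * tent x - (tent_prim (x + e) - tent_prim x)| <= 2 * e ^+ 2.
Proof.
have h1 := hinge_taylor (x + 1) e; have h2 := hinge_taylor x e; have h3 := hinge_taylor (x - 1) e.
have e1 : x + 1 + e = x + e + 1 by ring.
have e3 : x - 1 + e = x + e - 1 by ring.
move: h1 h2 h3; rewrite e1 e3 /tent_prim /tent !ler_norml.
by move=> /andP[? ?] /andP[? ?] /andP[? ?]; apply/andP; split; nra.
Qed.

(** Taylor errors add up over the K steps. The step [e] may have either sign, since it will be a
    slope times the mesh. *)
Lemma tent_sum a e K :
  `|\sum_(0 <= i < K) e * tent (a + i%:R * e) - (tent_prim (a + K%:R * e) - tent_prim a)|
    <= 2 * K%:R * e ^+ 2.
Proof.
elim: K => [|K IH].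
  by rewrite big_nil mul0r addr0 subrr subrr normr0 mulr0 mul0r.
rewrite big_nat_recr //=.
have h := tent_prim_taylor (a + K%:R * e) e.
have e1 : a + K.+1%:R * e = a + K%:R * e + e by rewrite -natr1; ring.
rewrite e1 -[K.+1%:R]natr1.
move: IH h; rewrite !ler_norml => /andP[? ?] /andP[? ?].
by apply/andP; split; nra.
Qed.

Definition bump P x := P * tent (P * x).
(** Both bumps have mass 1, so [osc P] has mean 0; the factor 256 makes it the increment between
    consecutive scales [256 ^+ k]. *)
Definition osc P x := bump (256 * P) x - bump P x.

Lemma bump_bound P x : 0 <= P -> 0 <= bump P x <= P.
Proof.
move=> P0; have /andP[h1 h2] := tent_bound (P * x).
by rewrite /bump mulr_ge0 //= ler_piMr.
Qed.

Lemma bump_out P x : 0 < P -> P^-1 <= `|x| -> bump P x = 0.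
Proof.
move=> P0 h; rewrite /bump tent_out ?mulr0 // normrM gtr0_norm //.
by rewrite -(mulfV (lt0r_neq0 P0)) ler_pM2l.
Qed.

Lemma bump_half P x : 0 < P -> `|x| <= 2^-1 * P^-1 -> P / 2 <= bump P x.
Proof.
move=> P0 h; rewrite /bump ler_pM2l // tent_half // normrM gtr0_norm //.
by rewrite -ler_pdivlMl // mulrC.
Qed.

Lemma bumpN P x : bump P (- x) = bump P x.
Proof. by rewrite /bump mulrN tentN. Qed.

Lemma bump_lip P x y : 0 <= P -> `|bump P x - bump P y| <= 4 * P ^+ 2 * `|x - y|.
Proof.
move=> P0; rewrite /bump -mulrBr normrM ger0_norm //.
apply: (le_trans (ler_wpM2l P0 (tent_lip _ _))).
by rewrite -mulrBr normrM (ger0_norm P0) expr2 le_eqVlt; apply/orP; left; apply/eqP; ring.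
Qed.

Lemma osc_bound P x : 0 <= P -> `|osc P x| <= 256 * P.
Proof.
move=> P0; have /andP[? ?] := bump_bound x P0.
have P1 : 0 <= 256 * P by lra.
have /andP[? ?] := bump_bound x P1.
by rewrite /osc ler_norml; apply/andP; split; lra.
Qed.

Lemma oscN P x : osc P (- x) = osc P x.
Proof. by rewrite /osc !bumpN. Qed.

Lemma osc_out P x : 0 < P -> P^-1 <= `|x| -> osc P x = 0.
Proof.
move=> P0 h; rewrite /osc !bump_out ?subrr //; first by lra.
apply: le_trans h; rewrite lef_pV2 ?posrE //; lra.
Qed.

Definition osc_lipc P : R := 2 * 512 ^+ 2 * P ^+ 2.

Lemma osc_lipc_ge0 P : 0 <= osc_lipc P.
Proof. by apply: mulr_ge0; rewrite ?sqr_ge0 // mulr_ge0 // sqr_ge0. Qed.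

Lemma osc_lip P x y : 0 <= P -> `|osc P x - osc P y| <= osc_lipc P * `|x - y|.
Proof.
rewrite /osc_lipc => P0; have h1 := bump_lip x y P0.
have h2 : `|bump (256 * P) x - bump (256 * P) y| <= 4 * (256 * P) ^+ 2 * `|x - y|.
  by apply: bump_lip; nra.
have h3 : 0 <= P ^+ 2 * `|x - y| by rewrite mulr_ge0 // exprn_ge0.
have -> : osc P x - osc P y = (bump (256 * P) x - bump (256 * P) y) - (bump P x - bump P y).
  by rewrite /osc; ring.
apply: (le_trans (ler_normB _ _)); nra.
Qed.

End Tent.

(** * Riemann sums over a uniform grid *)

Section Grid.
Variable R : realType.
Implicit Types (x y a e t u v P U : R).

(** When [h * J%:R = W], the indices below [2 * J] sweep [-W, W). *)
Definition gridpt (h : R) (J i : nat) : R := h * (i%:R - J%:R).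
Definition cut (V m : R) : R := hinge (V - `|m|).

Lemma cut_bound V m : 0 <= V -> 0 <= cut V m <= V.
Proof. by move=> V0; rewrite /cut; case: (hingeP (V - `|m|)) => -[? ->]; have := normr_ge0 m; lra. Qed.

Lemma cut_lip V m n : `|cut V m - cut V n| <= `|m - n|.
Proof.
apply: (le_trans (hinge_lip _ _)).
have -> : V - `|m| - (V - `|n|) = `|n| - `|m| by ring.
by rewrite [X in _ <= X]distrC; apply: ler_dist_dist.
Qed.

Lemma cut_out V m : V <= `|m| -> cut V m = 0.
Proof. by move=> h; rewrite /cut; case: (hingeP (V - `|m|)) => -[? ->]; lra. Qed.

Lemma cut_ge1 V m : `|m| <= V - 1 -> 1 <= cut V m.
Proof. by move=> h; rewrite /cut; case: (hingeP (V - `|m|)) => -[? ->]; lra. Qed.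

Variables (V W h : R) (J : nat).
Hypotheses (V0 : 0 <= V) (VW : V + 1 <= W) (h0 : 0 < h) (hJ : h * J%:R = W).
Let g := gridpt h J.

Let W0 : 0 <= W. Proof. by apply: le_trans VW; rewrite addr_ge0. Qed.

Lemma sum_bump P t u :
  `|u * (\sum_(0 <= i < 2 * J) h * bump P (t + g i * u))
    - (tent_prim (P * (t + W * u)) - tent_prim (P * (t - W * u)))|
   <= 4 * W * P ^+ 2 * u ^+ 2 * h.
Proof.
have e1 : u * (\sum_(0 <= i < 2 * J) h * bump P (t + g i * u)) =
   \sum_(0 <= i < 2 * J) (P * h * u) * tent (P * (t - W * u) + i%:R * (P * h * u)).
  rewrite big_distrr /=; apply: eq_bigr => i _.
  rewrite /bump /g /gridpt -hJ.
  have -> : P * (t - h * J%:R * u) + i%:R * (P * h * u) = P * (t + h * (i%:R - J%:R) * u) by ring.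
  by ring.
have e2 : P * (t + W * u) = P * (t - W * u) + (2 * J)%:R * (P * h * u).
  by rewrite natrM -hJ; ring.
rewrite e1 e2; apply: (le_trans (tent_sum _ _ _)).
by rewrite natrM -hJ le_eqVlt; apply/orP; left; apply/eqP; ring.
Qed.

Lemma sum_bump_ge0 P t u : 0 <= P -> 0 <= \sum_(0 <= i < 2 * J) h * bump P (t + g i * u).
Proof.
move=> P0; apply: sumr_ge0 => i _; apply: mulr_ge0; first exact: ltW.
by have /andP[] := bump_bound (t + g i * u) P0.
Qed.

Lemma sum_bump_le P t u : 0 <= P ->
  `|u| * (\sum_(0 <= i < 2 * J) h * bump P (t + g i * u)) <= 1 + 4 * W * P ^+ 2 * u ^+ 2 * h.
Proof.
move=> P0; have hb := sum_bump P t u.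
have s0 := sum_bump_ge0 t u P0.
rewrite -{1}(ger0_norm s0) -normrM.
set S := \sum_(_ <= _ < _) _ in hb s0 *.
have /andP[? ?] := tent_prim_bound (P * (t + W * u)).
have /andP[? ?] := tent_prim_bound (P * (t - W * u)).
by move: hb; rewrite !ler_norml => /andP[? ?]; apply/andP; split; lra.
Qed.

(** The zero -t / u lies in [-V, V], at distance at least 1 from the ends of the grid; as
    [1 <= P * |u|], the bump vanishes at these ends and is integrated whole. *)
Lemma sum_bump_eq P t u : 0 < P -> 1 <= P * `|u| -> `|t| <= V * `|u| ->
  `| `|u| * (\sum_(0 <= i < 2 * J) h * bump P (t + g i * u)) - 1|
    <= 4 * W * P ^+ 2 * u ^+ 2 * h.
Proof.
move=> P0 Pu tu; have hb := sum_bump P t u.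
set S := \sum_(_ <= _ < _) _ in hb *.
move: tu; rewrite ler_norml => /andP[t1 t2].
have wu : (V + 1) * `|u| <= W * `|u| by rewrite ler_wpM2r.
case: (ger0P u) Pu t1 t2 wu => [u0|u0] Pu t1 t2 wu.
  have Pt : P * u <= P * (t + W * u) by rewrite ler_pM2l //; nra.
  have Pt' : P * (t - W * u) <= P * - u by rewrite ler_pM2l //; nra.
  by move: hb; rewrite tent_prim_hi ?tent_prim_lo ?subr0 //; nra.
have Pt : P * (t + W * u) <= P * u by rewrite ler_pM2l //; nra.
have Pt' : P * - u <= P * (t - W * u) by rewrite ler_pM2l //; nra.
move: hb; rewrite tent_prim_lo ?tent_prim_hi ?sub0r //; try nra.
by rewrite mulNr -[X in `|X|]opprK normrN opprD opprK.
Qed.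

(** The bump acts as a Dirac mass at m = -t / u with Jacobian 1 / |u|. The cutoff, being
    1-Lipschitz, varies by at most 1 / (P |u|) over the support, which costs 1 / (P u^2); the rest
    is the Riemann error. *)
Lemma inner_bump P t u U : 0 < P -> 1 <= P * `|u| -> `|u| <= U ->
  `|\sum_(0 <= i < 2 * J) h * (cut V (g i) * bump P (t + g i * u)) - cut V (- t / u) / `|u| |
   <= (P * u ^+ 2)^-1 + (1 + V) * (4 * W * P ^+ 2 * U) * h.
Proof.
move=> P0 Pu uU.
have un0 : 0 < `|u| by nra.
have u0 : u != 0 by rewrite -normr_gt0.
have u2 : u ^+ 2 = `|u| ^+ 2 by rewrite -normrX ger0_norm // sqr_ge0.
have P0' := ltW P0.
have hle := sum_bump_le t u P0'.
have sge := sum_bump_ge0 t u P0'.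
have heq := sum_bump_eq (t := t) P0 Pu.
set S := \sum_(_ <= _ < _) _ in hle sge heq.
set T := \sum_(_ <= _ < _) _.
set c := cut V (- t / u).
have E0 : 0 <= 4 * W * P ^+ 2 * `|u| * h by rewrite !mulr_ge0 // ?exprn_ge0 // ltW.
have h1 : `|T - c * S| <= (P * `|u|)^-1 * S.
  rewrite /T /S !big_distrr /= -sumrB; apply: (le_trans (ler_norm_sum _ _ _)).
  apply: ler_sum => i _.
  have /andP[b1 b2] := bump_bound (t + g i * u) P0'.
  have -> : h * (cut V (g i) * bump P (t + g i * u)) - c * (h * bump P (t + g i * u)) =
     (cut V (g i) - c) * (h * bump P (t + g i * u)) by ring.
  rewrite normrM [X in _ * X <= _]ger0_norm; last by rewrite mulr_ge0 // ltW.
  have [far|near] := leP P^-1 `|t + g i * u|; first by rewrite bump_out ?mulr0.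
  apply: ler_wpM2r; first by rewrite mulr_ge0 // ltW.
  apply: (le_trans (cut_lip _ _ _)).
  have -> : g i - - t / u = (t + g i * u) / u by field.
  rewrite normrM normfV invfM; apply: ler_wpM2r; last exact: ltW.
  by rewrite invr_ge0.
have h2 : `|c * S - c / `|u| | <= V * (4 * W * P ^+ 2 * `|u| * h).
  have /andP[c0 cV] : 0 <= c <= V := cut_bound _ V0.
  (* Beyond the cutoff c = 0, and the bump, perhaps truncated by the end of the grid, does not
     matter. *)
  have [far|near] := leP V `| - t / u|.
    by rewrite /c cut_out // !mul0r subrr normr0 mulr_ge0.
  have tu : `|t| <= V * `|u|.
    by move: near; rewrite normrM normrN normfV ltr_pdivrMr // => /ltW.
  have := heq tu => {}heq.
  rewrite -mulrBr normrM (ger0_norm c0); apply: ler_pM => //.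
  have -> : S - `|u|^-1 = (`|u| * S - 1) / `|u| by field; rewrite gt_eqF.
  rewrite normrM normfV normr_id ler_pdivrMr //; apply: (le_trans heq).
  by rewrite u2 le_eqVlt; apply/orP; left; apply/eqP; ring.
have h3 : (P * `|u|)^-1 * S <= (P * u ^+ 2)^-1 + 4 * W * P ^+ 2 * `|u| * h.
  have -> : (P * `|u|)^-1 * S = (P * `|u|)^-1 / `|u| * (`|u| * S) by field; rewrite gt_eqF // gt_eqF.
  apply: (@le_trans _ _ ((P * `|u|)^-1 / `|u| * (1 + 4 * W * P ^+ 2 * u ^+ 2 * h))).
    by apply: ler_wpM2l => //; rewrite mulr_ge0 ?invr_ge0 ?mulr_ge0.
  rewrite mulrDr mulr1; apply: lerD; first by rewrite u2 -invfM expr2 mulrA.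
  have -> : (P * `|u|)^-1 / `|u| * (4 * W * P ^+ 2 * u ^+ 2 * h)
      = (P * `|u|)^-1 * (4 * W * P ^+ 2 * `|u| * h) by rewrite u2; field; rewrite !gt_eqF.
  by rewrite ler_piMl // invf_le1 // mulr_gt0.
have h4 : (1 + V) * (4 * W * P ^+ 2 * `|u| * h) <= (1 + V) * (4 * W * P ^+ 2 * U) * h.
  rewrite -!mulrA; apply: ler_wpM2l; first by rewrite addr_ge0.
  do 4 apply: ler_wpM2l => //.
  by apply: ler_wpM2r => //; exact: ltW.
have := ler_distD (c * S) T (c / `|u|); lra.
Qed.

(* The two bumps have the same integral, so only the variation of the cutoff
   over their support survives. *)
Lemma inner_osc P t u U : 0 < P -> 1 <= P * `|u| -> `|u| <= U ->
  `|\sum_(0 <= i < 2 * J) h * (cut V (g i) * osc P (t + g i * u))|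
   <= 2 * (P * u ^+ 2)^-1 + 2 * ((1 + V) * (4 * W * (256 * P) ^+ 2 * U)) * h.
Proof.
move=> P0 Pu uU.
have P1 : 0 < 256 * P by lra.
have Pu1 : 1 <= 256 * P * `|u| by rewrite -mulrA; lra.
have i1 := inner_bump t P0 Pu uU; have i2 := inner_bump t P1 Pu1 uU.
have u0 : u != 0 by rewrite -normr_gt0; have := normr_ge0 u; nra.
have u2 : 0 < u ^+ 2 by rewrite exprn_even_gt0.
have U0 : 0 <= U by apply: le_trans uU.
have -> : \sum_(0 <= i < 2 * J) h * (cut V (g i) * osc P (t + g i * u)) =
  \sum_(0 <= i < 2 * J) h * (cut V (g i) * bump (256 * P) (t + g i * u)) -
  \sum_(0 <= i < 2 * J) h * (cut V (g i) * bump P (t + g i * u)).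
  by rewrite -sumrB; apply: eq_bigr => i _; rewrite /osc; ring.
have h1 : (256 * P * u ^+ 2)^-1 <= (P * u ^+ 2)^-1.
  have le1 : P * u ^+ 2 <= 256 * P * u ^+ 2 by rewrite ler_pM2r //; lra.
  by rewrite lef_pV2 ?posrE //; apply: mulr_gt0.
have h2 : (1 + V) * (4 * W * P ^+ 2 * U) * h <= (1 + V) * (4 * W * (256 * P) ^+ 2 * U) * h.
  apply: ler_wpM2r; first exact: ltW.
  apply: ler_wpM2l; first by rewrite addr_ge0.
  apply: ler_wpM2r => //.
  apply: ler_wpM2l; first by rewrite mulr_ge0.
  by rewrite exprMn ler_peMl ?exprn_ge0 // ?exprn_ege1 //; lra.
have := ler_distD (cut V (- t / u) / `|u|)
  (\sum_(0 <= i < 2 * J) h * (cut V (g i) * bump (256 * P) (t + g i * u)))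
  (\sum_(0 <= i < 2 * J) h * (cut V (g i) * bump P (t + g i * u))).
rewrite [X in _ <= _ + X -> _]distrC; lra.
Qed.

Lemma sum_const_grid (c : R) : \sum_(0 <= i < 2 * J) h * c = 2 * W * c.
Proof. by rewrite sumr_const_nat subn0 -(mulr_natl (h * c)) natrM -hJ; ring. Qed.

Lemma inner_osc_triv P t u : 0 < P ->
  `|\sum_(0 <= i < 2 * J) h * (cut V (g i) * osc P (t + g i * u))| <= 2 * W * (V * (256 * P)).
Proof.
move=> P0; apply: (le_trans (ler_norm_sum _ _ _)).
rewrite -sum_const_grid; apply: ler_sum => i _.
rewrite normrM (gtr0_norm h0); apply: ler_wpM2l; first exact: ltW.
have /andP[c0 c1] := cut_bound (g i) V0.
rewrite normrM (ger0_norm c0); apply: ler_pM => //.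
by apply: osc_bound; exact: ltW.
Qed.

Lemma l1_osc P : 0 < P ->
  \sum_(0 <= j < 2 * J) h * `|osc P (g j)| <= 2 + 2 * (4 * W * (256 * P) ^+ 2) * h.
Proof.
move=> P0.
have P1 : 0 < 256 * P by lra.
have b1 := sum_bump_le 0 1 (ltW P0); have b2 := sum_bump_le 0 1 (ltW P1).
apply: (@le_trans _ _ (\sum_(0 <= i < 2 * J) h * bump (256 * P) (0 + g i * 1) +
   \sum_(0 <= i < 2 * J) h * bump P (0 + g i * 1))).
  rewrite -big_split /=; apply: ler_sum => i _.
  rewrite add0r mulr1 -mulrDr; apply: ler_wpM2l; first exact: ltW.
  have /andP[? ?] := bump_bound (g i) (ltW P0).
  have /andP[? ?] := bump_bound (g i) (ltW P1).
  by rewrite /osc ler_norml; apply/andP; split; lra.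
have h2 : 4 * W * P ^+ 2 * h <= (4 * W * (256 * P) ^+ 2) * h.
  apply: ler_wpM2r; first exact: ltW.
  apply: ler_wpM2l; first by rewrite mulr_ge0.
  by rewrite exprMn ler_peMl ?exprn_ge0 // ?exprn_ege1 //; lra.
move: b1 b2; rewrite normr1 expr1n !mulr1 !mul1r; lra.
Qed.

End Grid.

(** * Discrete kernel estimates *)

Section Shift.
Variable R : realType.
Variables (W h : R) (J : nat).
Hypotheses (h0 : 0 < h) (hJ : h * J%:R = W).
Let g := gridpt h J.

Lemma grid_shift_nat (F : R -> R) n :
  (forall y, W <= y -> F y = 0) -> (forall y, y < - W + h * n%:R -> F y = 0) ->
  \sum_(0 <= j < 2 * J) F (g j + h * n%:R) = \sum_(0 <= j < 2 * J) F (g j).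
Proof.
move=> Fhi; elim: n => [|n IH] Flo.
  by apply: eq_bigr => j _; rewrite mulr0 addr0.
rewrite -IH; last by move=> y hy; apply: Flo; rewrite -natr1 mulrDr mulr1; move: h0; lra.
have gS j : g j + h * n.+1%:R = g j.+1 + h * n%:R by rewrite /g /gridpt -!natr1; ring.
under eq_bigr do rewrite gS.
have := big_nat_recr (2 * J) 0 (fun j => F (g j + h * n%:R)) (leq0n _) (op := +%R) (idx := 0).
rewrite big_nat_recl //= => eq1.
have F0 : F (g 0%N + h * n%:R) = 0.
  have e : h * n.+1%:R = h * n%:R + h by rewrite -natr1; ring.
  by apply: Flo; rewrite /g /gridpt e -hJ sub0r; move: h0; lra.
have FN : F (g (2 * J)%N + h * n%:R) = 0.
  apply: Fhi; rewrite /g /gridpt natrM -hJ.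
  have : 0 <= h * n%:R by rewrite mulr_ge0 // ltW.
  by rewrite [h * (_ - _)](_ : _ = h * J%:R) => [|//]; [lra|ring].
by move: eq1; rewrite F0 FN add0r addr0.
Qed.

(** The nodes that enter or leave the grid under the shift lie where [F] vanishes, so there is no
    error term. *)
Lemma grid_shift (F : R -> R) (r : int) :
  (forall y, W - `|h * r%:~R| <= y -> F y = 0) ->
  (forall y, y < - W + `|h * r%:~R| -> F y = 0) ->
  \sum_(0 <= j < 2 * J) F (g j + h * r%:~R) = \sum_(0 <= j < 2 * J) F (g j).
Proof.
have h0' := ltW h0.
case: r => n Fhi Flo.
  have e : `|h * n%:~R| = h * n%:R by rewrite ger0_norm // mulr_ge0.
  apply: grid_shift_nat => y hy; [apply: Fhi | apply: Flo]; rewrite ?e //.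
  by have : 0 <= h * n%:R :> R; [rewrite mulr_ge0 | move: hy; lra].
have e1 : h * (Negz n)%:~R = - (h * n.+1%:R) by rewrite NegzE mulrNz mulrN.
have p0 : 0 <= h * n.+1%:R by rewrite mulr_ge0.
have e : `|h * (Negz n)%:~R| = h * n.+1%:R by rewrite e1 normrN ger0_norm.
rewrite e1 -(@grid_shift_nat (fun y => F (y - h * n.+1%:R)) n.+1) => [|y hy|y hy].
- by apply: eq_bigr => j _; rewrite addrK.
- by apply: Fhi; rewrite e; lra.
- by apply: Flo; rewrite e; lra.
Qed.

End Shift.

(** Error constants, to be multiplied by the mesh: [kernel_c1] for the L^1 norm of [osc],
    [kernel_c2] for the rounding of two lines, which moves an argument by at most 2 h. *)
Definition kernel_c1 (R : realType) (W P : R) : R := 2 * (4 * W * (256 * P) ^+ 2).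
Definition kernel_c2 (R : realType) (V W P : R) : R := 2 * W * (V * (osc_lipc P * 2)).

Lemma kernel_c2_ge0 (R : realType) (V W P : R) : 0 <= V -> 0 <= W -> 0 <= kernel_c2 V W P.
Proof.
move=> V0 W0; apply: mulr_ge0; first exact: mulr_ge0.
by apply: mulr_ge0 => //; apply: mulr_ge0; first exact: osc_lipc_ge0.
Qed.

Section Kernel.
Variable R : realType.
Variables (M V W h P : R) (J : nat).
Hypotheses (M0 : 0 <= M) (V0 : 0 <= V) (VW : V + 1 <= W) (MW : 2 * (M * V + M + 2) <= W).
Hypotheses (h0 : 0 < h) (h1 : h <= 1) (hJ : h * J%:R = W) (P1 : 1 <= P).
Let g := gridpt h J.
Variables (x1 x2 y1 y2 : R) (r q : nat -> int).
Hypotheses (x1M : `|x1| <= M) (x2M : `|x2| <= M) (y1M : `|y1| <= M).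
Hypothesis rx : forall i, `|h * (r i)%:~R - (x1 * g i - x2)| <= h.
Hypothesis qy : forall i, `|h * (q i)%:~R - (y1 * g i - y2)| <= h.

(** In units of h, [r i] and [q i] are the rounded heights over column i of the lines m -> x1 m - x2
    and m -> y1 m - y2. *)
Definition pair_kernel := \sum_(0 <= i < 2 * J) h * (cut V (g i) *
  \sum_(0 <= j < 2 * J) h * (osc P (h * (r i)%:~R - g j) * osc P (h * (q i)%:~R - g j))).

Let P0 : 0 < P. Proof. exact: lt_le_trans P1. Qed.
Let PV1 : P^-1 <= 1. Proof. by rewrite invf_le1. Qed.
Let W0 : 0 <= W. Proof. by apply: le_trans VW; rewrite addr_ge0. Qed.

(** Translating each column by the height of the first line makes the first factor independent of
    the column, so that m can be summed first. *)
Lemma pair_kernel_shift : pair_kernel = \sum_(0 <= j < 2 * J) h * (osc P (g j) *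
  \sum_(0 <= i < 2 * J) h * (cut V (g i) * osc P (h * (q i)%:~R - h * (r i)%:~R - g j))).
Proof.
transitivity (\sum_(0 <= i < 2 * J) h * (cut V (g i) *
  \sum_(0 <= j < 2 * J) h * (osc P (g j) * osc P (h * (q i)%:~R - h * (r i)%:~R - g j)))).
  apply: eq_bigr => i _; congr (_ * _).
  have [far|near] := leP V `|g i|; first by rewrite cut_out // !mul0r.
  congr (_ * _); rewrite -!big_distrr /=; congr (_ * _).
  (* [W] has room for this height twice, once for the place of the support and once for the shift,
     and for the half-width 1 / P <= 1 of [osc]. *)
  have hr : `|h * (r i)%:~R| <= M * V + M + 1.
    have h3 : `|x1 * g i| <= M * V by rewrite normrM ler_pM // ltW.
    have h4 := rx i; move: h3 h4 x2M h1; rewrite !ler_norml => /andP[? ?] /andP[? ?] /andP[? ?] ?.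
    by apply/andP; split; lra.
  rewrite -(@grid_shift _ W h J h0 hJ
    (fun y => osc P (h * (r i)%:~R - y) * osc P (h * (q i)%:~R - y)) (r i)) => [|y hy|y hy].
  - by apply: eq_bigr => j _; rewrite opprD addrCA subrr addr0 oscN addrA addrAC.
  - rewrite osc_out ?mul0r //; apply: (le_trans PV1); rewrite distrC.
    apply: (le_trans _ (ler_norm _)); have := hr; rewrite ler_norml => /andP[? ?].
    by have := ler_norm (h * (r i)%:~R); move: hy MW; lra.
  - rewrite osc_out ?mul0r //; apply: (le_trans PV1).
    apply: (le_trans _ (ler_norm _)); have := hr; rewrite ler_norml => /andP[? ?].
    by have := ler_norm (- (h * (r i)%:~R)); rewrite normrN; move: hy MW; lra.
under eq_bigr do rewrite !big_distrr /=.
rewrite exchange_big /=; apply: eq_bigr => j _.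
by rewrite !big_distrr /=; apply: eq_bigr => i _; ring.
Qed.

(** [B] bounds the sum over m uniformly in c, and 3 bounds the L^1 norm of [osc] once the mesh error
    is at most 1. *)
Lemma pair_kernel_le B : kernel_c1 W P * h <= 1 ->
  (forall t, `|\sum_(0 <= i < 2 * J) h * (cut V (g i) * osc P (t + g i * (y1 - x1)))| <= B) ->
  `|pair_kernel| <= 3 * (B + kernel_c2 V W P * h).
Proof.
move=> hK HB; rewrite pair_kernel_shift.
have h0' := ltW h0; have P0' := ltW P0.
have B0 : 0 <= B by apply: le_trans (HB 0).
have K20 : 0 <= kernel_c2 V W P * h.
  by rewrite mulr_ge0 // kernel_c2_ge0.
apply: (@le_trans _ _ ((\sum_(0 <= j < 2 * J) h * `|osc P (g j)|) * (B + kernel_c2 V W P * h))); last first.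
  apply: ler_wpM2r; first exact: addr_ge0.
  by apply: (le_trans (l1_osc V0 VW h0 hJ P0)); move: hK; rewrite /kernel_c1; lra.
apply: (le_trans (ler_norm_sum _ _ _)); rewrite big_distrl /=; apply: ler_sum => j _.
rewrite normrM (gtr0_norm h0) normrM mulrA; apply: ler_wpM2l; first by rewrite mulr_ge0.
set t := - (y2 - x2) - g j.
apply: (@le_trans _ _ (`|\sum_(0 <= i < 2 * J) h * (cut V (g i) * osc P (t + g i * (y1 - x1)))| + kernel_c2 V W P * h)); last by rewrite lerD2r.
rewrite -lerBlDl; apply: (le_trans (lerB_dist _ _)).
rewrite -sumrB; apply: (le_trans (ler_norm_sum _ _ _)).
have -> : kernel_c2 V W P * h = 2 * W * (V * (osc_lipc P * (2 * h))) by rewrite /kernel_c2; ring.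
rewrite -(sum_const_grid hJ); apply: ler_sum => i _.
rewrite -mulrBr normrM (gtr0_norm h0); apply: ler_wpM2l => //.
have /andP[c0 c1] := cut_bound (g i) V0.
rewrite -mulrBr normrM (ger0_norm c0); apply: ler_pM => //.
apply: (le_trans (osc_lip _ _ P0')); apply: ler_wpM2l; first exact: osc_lipc_ge0.
have := rx i; have := qy i; rewrite /t !ler_norml => /andP[? ?] /andP[? ?].
by apply/andP; split; lra.
Qed.

Lemma pair_kernel_near : kernel_c1 W P * h <= 1 -> `|pair_kernel| <= 3 * (2 * W * (V * (256 * P)) + kernel_c2 V W P * h).
Proof. by move=> hK; apply: pair_kernel_le => // t; exact: inner_osc_triv. Qed.

Lemma pair_kernel_far : kernel_c1 W P * h <= 1 -> 1 <= P * `|y1 - x1| ->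
  `|pair_kernel| <= 3 * (2 * (P * (y1 - x1) ^+ 2)^-1
    + 2 * ((1 + V) * (4 * W * (256 * P) ^+ 2 * (2 * M))) * h + kernel_c2 V W P * h).
Proof.
move=> hK Pu; apply: pair_kernel_le => // t; apply: inner_osc => //.
by apply: (le_trans (ler_normB _ _)); move: x1M y1M; lra.
Qed.

(** Within the cutoff the two lines stay 3 / P apart: 2 / P separates the supports of the two [osc],
    and the third 1 / P absorbs the rounding error 2 h. *)
Lemma pair_kernel_zero : 2 * P * h <= 1 -> V * `|y1 - x1| + 3 / P <= `|y2 - x2| -> pair_kernel = 0.
Proof.
move=> hP far; rewrite /pair_kernel big1 // => i _.
have [gfar|gnear] := leP V `|g i|; first by rewrite cut_out // mul0r mulr0.
rewrite big1 ?mulr0 // => j _.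
have [f1|n1] := leP P^-1 `|h * (r i)%:~R - g j|; first by rewrite osc_out // mul0r mulr0.
have [f2|n2] := leP P^-1 `|h * (q i)%:~R - g j|; first by rewrite (osc_out _ f2) // !mulr0.
exfalso; have := rx i; have := qy i; move: n1 n2.
have hu : `|(y1 - x1) * g i| <= V * `|y1 - x1|.
  by rewrite normrM mulrC ler_pM // ltW.
have hP2 : 2 * h <= P^-1 by rewrite -[P^-1]mul1r ler_pdivlMr // mulrAC.
move: far; rewrite leNgt => /negP far.
rewrite !ltr_norml !ler_norml => /andP[? ?] /andP[? ?] /andP[? ?] /andP[? ?].
move: hu; rewrite ler_norml => /andP[? ?].
by apply: far; rewrite ltr_norml; apply/andP; split; lra.
Qed.

End Kernel.

Lemma sum_expand (R : comNzRingType) (T : eqType) (S : seq (R * T)) (F : T -> R) :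
  (\sum_(z <- S) z.1 * F z.2) ^+ 2 =
  \sum_(z <- S) \sum_(z' <- S) z.1 * z'.1 * (F z.2 * F z'.2).
Proof.
rewrite expr2 big_distrl /=; apply: eq_bigr => z _.
by rewrite big_distrr /=; apply: eq_bigr => z' _; ring.
Qed.

(** * Energy of a weighted point set *)

Section Energy.
Variable R : realType.
Implicit Types (k l : nat) (S : seq (R * (R * R))).

Definition box (a : R) (p q : R * R) := (`|q.1 - p.1| <= a) && (`|q.2 - p.2| <= a).

(** If r lies between 16^-(l+1) and 16^-l, the term of level l alone suffices. The singular kernel
    becomes a sum over scales, to which the bound on the mass of boxes applies level by level. *)
Lemma inv_sqr_levels (L : nat) (r : R) : (16^-1) ^+ L < r ->
  (r ^+ 2)^-1 <= 1 + \sum_(0 <= l < L) 256 ^+ l.+1 * (r <= (16^-1) ^+ l)%R%:R.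
Proof.
elim: L => [|L IH] hr.
  rewrite big_nil addr0 expr0 in hr *.
  by rewrite invf_le1 ?exprn_gt0 ?exprn_ege1 ?ltW //; lra.
rewrite big_nat_recr //=.
have [big|small] := ltP ((16^-1) ^+ L) r.
  by have := IH big; rewrite mulr0 addr0.
rewrite mulr1; have s0 : 0 <= \sum_(0 <= l < L) (256 : R) ^+ l.+1 * (r <= (16^-1) ^+ l)%R%:R.
  by apply: sumr_ge0 => l _; rewrite mulr_ge0 ?exprn_ge0.
have r0 : 0 < r by apply: le_lt_trans hr; rewrite exprn_ge0 // invr_ge0.
have : (r ^+ 2)^-1 <= 256 ^+ L.+1.
  have -> : (256 : R) ^+ L.+1 = (((16^-1) ^+ L.+1) ^+ 2)^-1.
    rewrite exprVn exprVn invrK -exprM mulnC exprM; congr (_ ^+ _); ring.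
  rewrite lef_pV2 ?posrE ?exprn_gt0 ?invr_gt0 //.
  by rewrite lerXn2r ?nnegrE ?exprn_ge0 ?invr_ge0 // ltW.
lra.
Qed.

(** The kernel bound sees only the difference of first coordinates. Where the kernel does not
    vanish, that difference controls the second coordinates as well, and the pair lies in a common
    box. *)
Lemma near_box (V a e : R) (p q : R * R) : 0 <= V -> `|q.1 - p.1| <= a -> e <= a ->
  `|q.2 - p.2| < V * `|q.1 - p.1| + 3 * e -> box ((V + 3) * a) p q.
Proof.
move=> V0 ua ea near.
have Vu : V * `|q.1 - p.1| <= V * a by rewrite ler_wpM2l.
have Va : 0 <= V * a by rewrite mulr_ge0 // (le_trans _ ua).
have u0 := normr_ge0 (q.1 - p.1).
by apply/andP; split; lra.
Qed.

Lemma geom2_sum k : \sum_(0 <= l < k) (2 : R) ^+ l <= 2 ^+ k.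
Proof.
elim: k => [|k IH]; first by rewrite big_nil.
by rewrite big_nat_recr //= exprS; lra.
Qed.

(* Rounding to the grid makes translations in the second grid variable exact. *)
Definition row_round (h : R) (J : nat) (p : R * R) i : int :=
  Num.floor ((p.1 * gridpt h J i - p.2) / h).

Definition grid_density (h : R) (J : nat) (P : R) S i j :=
  \sum_(z <- S) z.1 * osc P (h * (row_round h J z.2 i)%:~R - gridpt h J j).

Lemma row_roundP (h : R) J p i : 0 < h -> `|h * (row_round h J p i)%:~R - (p.1 * gridpt h J i - p.2)| <= h.
Proof.
move=> h0; have /andP[l1 l2] := Num.Theory.floor_itv ((p.1 * gridpt h J i - p.2) / h).
move: l1 l2; rewrite -/(row_round h J p i) intrD ler_pdivlMr // ltr_pdivrMr // => l1 l2.
by rewrite ler_norml; apply/andP; split; lra.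
Qed.

Definition kernel_c3 (M V W P : R) : R :=
  6 * ((1 + V) * (4 * W * (256 * P) ^+ 2 * (2 * M))) + 3 * kernel_c2 V W P.

Lemma enK_parts_ge0 (M V W P : R) : 0 <= M -> 0 <= V -> 0 <= W ->
  0 <= 6 * ((1 + V) * (4 * W * (256 * P) ^+ 2 * (2 * M))) /\ 0 <= 3 * kernel_c2 V W P.
Proof.
move=> M0 V0 W0; split; last by apply: mulr_ge0 => //; exact: kernel_c2_ge0.
apply: mulr_ge0 => //; apply: mulr_ge0; first exact: addr_ge0.
apply: mulr_ge0; last exact: mulr_ge0.
apply: mulr_ge0; last exact: sqr_ge0.
exact: mulr_ge0.
Qed.

Lemma enK_ge0 (M V W P : R) : 0 <= M -> 0 <= V -> 0 <= W -> 0 <= kernel_c3 M V W P.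
Proof. by move=> M0 V0 W0; have [? ?] := enK_parts_ge0 P M0 V0 W0; exact: addr_ge0. Qed.

Section Fixed.
Variables (M V W h : R) (J k : nat).
Hypotheses (M0 : 0 <= M) (V0 : 0 <= V) (VW : V + 1 <= W) (MW : 2 * (M * V + M + 2) <= W).
Hypotheses (h0 : 0 < h) (h1 : h <= 1) (hJ : h * J%:R = W).
Let P : R := 256 ^+ k.
Let g := gridpt h J.
Hypotheses (hK : kernel_c1 W P * h <= 1) (hP : 2 * P * h <= 1).

Let row_round := row_round h J.
Let row_roundP p i : `|h * (row_round p i)%:~R - (p.1 * g i - p.2)| <= h. Proof. exact: row_roundP. Qed.

Let P1 : 1 <= P. Proof. by rewrite exprn_ege1 //; lra. Qed.
Let P0 : 0 < P. Proof. exact: lt_le_trans P1. Qed.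
Let W0 : 0 <= W. Proof. by apply: le_trans VW; rewrite addr_ge0. Qed.

Lemma pair_kernel_levels (p q : R * R) :
  `|p.1| <= M -> `|p.2| <= M -> `|q.1| <= M ->
  pair_kernel V h P J (row_round p) (row_round q) <= (1536 * W * V + 6) / P *
     (1 + \sum_(0 <= l < (2 * k).+1) 256 ^+ l.+1 * (box ((V + 3) * (16^-1) ^+ l) p q)%R%:R)
     + kernel_c3 M V W P * h.
Proof.
move=> p1 p2 q1.
have e16 : P^-1 = (16^-1) ^+ (2 * k).
  by rewrite /P -exprVn exprM; congr (_ ^+ _); rewrite expr2 -invfM; congr (_^-1); ring.
have [K30 K20] := enK_parts_ge0 P M0 V0 W0.
have K0 : 0 <= kernel_c3 M V W P * h by apply: mulr_ge0; [exact: enK_ge0 | exact: ltW].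
have S0 : 0 <= \sum_(0 <= l < (2 * k).+1) (256 : R) ^+ l.+1 * (box ((V + 3) * (16^-1) ^+ l) p q)%R%:R.
  by apply: sumr_ge0 => l _; rewrite mulr_ge0 ?exprn_ge0.
have C0 : 0 <= 1536 * W * V by rewrite !mulr_ge0.
have PV0 : 0 < P^-1 by rewrite invr_gt0.
have [far|near] := leP (V * `|q.1 - p.1| + 3 / P) `|q.2 - p.2|.
  have -> : pair_kernel V h P J (row_round p) (row_round q) = 0.
    by apply: (pair_kernel_zero P1 (row_roundP p) (row_roundP q)).
  by rewrite addr_ge0 // !mulr_ge0 ?addr_ge0 // invr_ge0 ltW.
have un0 := normr_ge0 (q.1 - p.1).
have [ubig|usmall] := leP P^-1 `|q.1 - p.1|.
  have Pu : 1 <= P * `|q.1 - p.1| by rewrite -(mulfV (lt0r_neq0 P0)) ler_pM2l.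
  have kb := pair_kernel_far V0 VW MW h0 h1 hJ P1 p1 p2 q1 (row_roundP p) (row_roundP q) hK Pu.
  apply: (le_trans (ler_norm _)); apply: (le_trans kb).
  have ur : (16^-1) ^+ (2 * k).+1 < `|q.1 - p.1|.
    apply: lt_le_trans ubig; rewrite e16 exprS gtr_pMl ?exprn_gt0 ?invr_gt0 // invf_lt1 //; lra.
  have := inv_sqr_levels ur; rewrite -normrX ger0_norm ?sqr_ge0 // => hl.
  have hS : \sum_(0 <= l < (2 * k).+1) (256 : R) ^+ l.+1 * (`|q.1 - p.1| <= (16^-1) ^+ l)%R%:R
    <= \sum_(0 <= l < (2 * k).+1) (256 : R) ^+ l.+1 * (box ((V + 3) * (16^-1) ^+ l) p q)%R%:R.
    apply: ler_sum => l _; apply: ler_wpM2l; first exact: exprn_ge0.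
    have [le|] := boolP (`|q.1 - p.1| <= (16^-1) ^+ l); last by rewrite ler0n.
    suff -> : box ((V + 3) * (16^-1) ^+ l) p q by [].
    by apply: near_box near => //; exact: le_trans le.
  rewrite invfM.
  have PS : P^-1 * ((q.1 - p.1) ^+ 2)^-1 <= P^-1 * (1 + \sum_(0 <= l < (2 * k).+1) (256 : R) ^+ l.+1 * (box ((V + 3) * (16^-1) ^+ l) p q)%R%:R).
    by rewrite ler_pM2l //; apply: (le_trans hl); rewrite lerD2l.
  have CS : 0 <= 1536 * W * V / P * (1 + \sum_(0 <= l < (2 * k).+1) (256 : R) ^+ l.+1 * (box ((V + 3) * (16^-1) ^+ l) p q)%R%:R).
    by rewrite !mulr_ge0 // ?addr_ge0 // ltW.
  rewrite /kernel_c3; set X := \sum_(_ <= _ < _) _ in PS CS *.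
  set a := 1536 * W * V in CS *; set b := (1 + V) * _; set c := kernel_c2 V W P.
  have -> : (a + 6) / P * (1 + X) = a / P * (1 + X) + 6 * (P^-1 * (1 + X)) by ring.
  lra.
(* Now |u| < 1 / P, and the trivial bound O(P) = O(P^2) / P is absorbed by the finest level l = 2 k,
   whose weight 256^(2k+1) exceeds P^2. *)
have kb := pair_kernel_near V0 VW MW h0 h1 hJ P1 p1 p2 (row_roundP p) (row_roundP q) hK.
apply: (le_trans (ler_norm _)); apply: (le_trans kb).
have hb : box ((V + 3) * (16^-1) ^+ (2 * k)) p q.
  by rewrite -e16; apply: near_box near => //; exact: ltW.
have hS : P ^+ 2 <= \sum_(0 <= l < (2 * k).+1) (256 : R) ^+ l.+1 * (box ((V + 3) * (16^-1) ^+ l) p q)%R%:R.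
  rewrite big_nat_recr //= hb mulr1.
  have : 0 <= \sum_(0 <= l < 2 * k) (256 : R) ^+ l.+1 * (box ((V + 3) * (16^-1) ^+ l) p q)%R%:R.
    by apply: sumr_ge0 => l _; rewrite mulr_ge0 ?exprn_ge0.
  have : P ^+ 2 <= 256 ^+ (2 * k).+1.
    by rewrite /P -exprM mulnC exprS ler_peMl ?exprn_ge0 //; lra.
  lra.
have e : 2 * W * (V * (256 * P)) * 3 = 1536 * W * V / P * P ^+ 2 by field; rewrite gt_eqF.
have : 1536 * W * V / P * P ^+ 2 <= (1536 * W * V + 6) / P * (1 + \sum_(0 <= l < (2 * k).+1) (256 : R) ^+ l.+1 * (box ((V + 3) * (16^-1) ^+ l) p q)%R%:R).
  apply: ler_pM; rewrite ?sqr_ge0 // ?mulr_ge0 ?(ltW PV0) //; first by rewrite ler_pM2r //; lra.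
  lra.
have : 3 * (kernel_c2 V W P * h) <= kernel_c3 M V W P * h.
  rewrite mulrA; apply: ler_wpM2r; first exact: ltW.
  by rewrite /kernel_c3; lra.
lra.
Qed.

Variables (S : seq (R * (R * R))) (C : R).
Hypothesis S0 : forall z, z \in S -> 0 <= z.1 /\ `|z.2.1| <= M /\ `|z.2.2| <= M.
Hypothesis S1 : \sum_(z <- S) z.1 = 1.
Hypothesis SF : forall l q, (l <= 2 * k)%N ->
  \sum_(z <- S | box ((V + 3) * (16^-1) ^+ l) q z.2) z.1 <= C * (128^-1) ^+ l.

Let grid_density := grid_density h J P S.

(** At level l the weight 256^l meets the mass 128^-l, so the finest level dominates with 2^(2k) =
    4^k; divided by P = 256^k this is 64^-k. *)
Lemma energy :
  \sum_(0 <= i < 2 * J) h * (cut V (g i) * \sum_(0 <= j < 2 * J) h * grid_density i j ^+ 2)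
  <= (1536 * W * V + 6) * (1 + 512 * C) * (64^-1) ^+ k + kernel_c3 M V W P * h.
Proof.
have C0 : 0 <= C.
  have := SF (0, 0) (leq0n _); rewrite expr0 !mulr1; apply: le_trans.
  by rewrite big_seq_cond; apply: sumr_ge0 => z /andP[/S0[]].
have -> : \sum_(0 <= i < 2 * J) h * (cut V (g i) * \sum_(0 <= j < 2 * J) h * grid_density i j ^+ 2)
  = \sum_(z <- S) \sum_(z' <- S) z.1 * z'.1 * pair_kernel V h P J (row_round z.2) (row_round z'.2).
  rewrite /pair_kernel.
  under [RHS]eq_bigr do under eq_bigr do rewrite big_distrr /=.
  under [RHS]eq_bigr do rewrite exchange_big /=.
  rewrite [RHS]exchange_big /=; apply: eq_bigr => i _.
  rewrite mulrA big_distrr /=.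
  under [RHS]eq_bigr do under eq_bigr do rewrite mulrA mulrA big_distrr /=.
  under [RHS]eq_bigr do rewrite exchange_big /=.
  rewrite [RHS]exchange_big /=; apply: eq_bigr => j _.
  rewrite /grid_density (sum_expand S (fun p => osc P (h * (row_round p i)%:~R - g j))) !big_distrr /=; apply: eq_bigr => z _.
  by rewrite !big_distrr /=; apply: eq_bigr => z' _; rewrite /g; ring.
set B := (1536 * W * V + 6) / P.
have B0 : 0 <= B by rewrite /B mulr_ge0 ?addr_ge0 // ?mulr_ge0 // invr_ge0 ltW.
apply: (@le_trans _ _ (\sum_(z <- S) z.1 * (\sum_(z' <- S) z'.1 *
  (B * (1 + \sum_(0 <= l < (2 * k).+1) 256 ^+ l.+1 * (box ((V + 3) * (16^-1) ^+ l) z.2 z'.2)%R%:R) + kernel_c3 M V W P * h)))).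
  rewrite big_seq [X in _ <= X]big_seq; apply: ler_sum => z /S0[z0 [zM zM']].
  rewrite big_distrr /= big_seq [X in _ <= X]big_seq; apply: ler_sum => z' /S0[z0' [zM1 _]].
  rewrite mulrA; apply: ler_wpM2l; first exact: mulr_ge0.
  exact: pair_kernel_levels.
have -> : (1536 * W * V + 6) * (1 + 512 * C) * (64^-1) ^+ k + kernel_c3 M V W P * h = \sum_(z <- S) z.1 *
  ((1536 * W * V + 6) * (1 + 512 * C) * (64^-1) ^+ k + kernel_c3 M V W P * h) by rewrite -big_distrl /= S1 mul1r.
rewrite big_seq [X in _ <= X]big_seq; apply: ler_sum => z zS.
have [z0 _] := S0 zS; apply: ler_wpM2l => //.
under eq_bigr do rewrite mulrDr.
rewrite big_split /= -big_distrl /= S1 mul1r lerD2r.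
have -> : \sum_(z' <- S) z'.1 * (B * (1 + \sum_(0 <= l < (2 * k).+1) 256 ^+ l.+1 * (box ((V + 3) * (16^-1) ^+ l) z.2 z'.2)%R%:R))
  = B * (1 + \sum_(0 <= l < (2 * k).+1) 256 ^+ l.+1 * \sum_(z' <- S | box ((V + 3) * (16^-1) ^+ l) z.2 z'.2) z'.1).
  under [in RHS]eq_bigr do rewrite big_mkcond big_distrr /=.
  rewrite -[X in B * (X + _)]S1.
  rewrite exchange_big /= -big_split /= big_distrr /=; apply: eq_bigr => z' _.
  rewrite mulrCA mulrDr mulr1 big_distrr /=; congr (_ * (_ + _)); apply: eq_bigr => l _.
  by case: ifP => _; rewrite ?mulr1 ?mulr0 // mulrC.
have hS : \sum_(0 <= l < (2 * k).+1) 256 ^+ l.+1 * \sum_(z' <- S | box ((V + 3) * (16^-1) ^+ l) z.2 z'.2) z'.1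
   <= 256 * C * 2 ^+ (2 * k).+1.
  apply: (@le_trans _ _ (\sum_(0 <= l < (2 * k).+1) 256 * C * 2 ^+ l)); last first.
    by rewrite -big_distrr /=; apply: ler_wpM2l; [rewrite mulr_ge0|exact: geom2_sum].
  rewrite big_seq [X in _ <= X]big_seq; apply: ler_sum => l; rewrite mem_index_iota => /andP[_ lk].
  have e : 256 ^+ l.+1 * (C * (128^-1) ^+ l) = 256 * C * 2 ^+ l.
    have -> : (2 : R) ^+ l = (256 * 128^-1) ^+ l by congr (_ ^+ _); field.
    by rewrite exprMn exprS; ring.
  by rewrite -e; apply: ler_wpM2l; [exact: exprn_ge0 | exact: SF].
have e4 : (2 : R) ^+ (2 * k).+1 = 2 * 4 ^+ k.
  by rewrite exprS exprM; congr (_ * _ ^+ _); ring.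
have p4 : 1 <= (4 : R) ^+ k by rewrite exprn_ege1 //; lra.
have e64 : (64^-1 : R) ^+ k = P^-1 * 4 ^+ k.
  by rewrite /P -exprVn -exprMn; congr (_ ^+ _); field.
rewrite e64 /B.
have -> : (1536 * W * V + 6) * (1 + 512 * C) * (P^-1 * 4 ^+ k) = (1536 * W * V + 6) / P * ((1 + 512 * C) * 4 ^+ k) by ring.
apply: ler_wpM2l => //.
by move: hS; rewrite e4; lra.
Qed.

End Fixed.
End Energy.

(** * The smoothing estimate *)

Lemma sum_window (R : zmodType) (F : nat -> R) (a n K : nat) : (a + n <= K)%N ->
  \sum_(a <= i < a + n) F i = \sum_(0 <= i < K | (a <= i < a + n)%N) F i.
Proof.
move=> le; rewrite (big_nat_widen _ _ K) // (big_nat_widenl _ 0) //.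
by apply: eq_bigl => i; rewrite andbC.
Qed.

Section LocalAverage.
Variable R : realType.
Variables (M W h P : R) (J N : nat).
(** The cutoff is then at least 1 on [-M - 1, M + 1], which contains every window of side H <= 1
    around a point of [-M, M]. *)
Let V : R := M + 2.
Let H : R := N%:R * h.
Let g := gridpt h J.
Hypotheses (P0 : 0 <= P) (M0 : 0 <= M) (VW : V + 1 <= W) (h0 : 0 < h) (N0 : (0 < N)%N) (H1 : H <= 1).
Hypothesis hJ : h * J%:R = W.
Variables (S S' : seq (R * (R * R))) (mm cc : R * R -> R) (L : R).
Hypothesis S0 : forall z, z \in S -> 0 <= z.1 /\ `|z.2.1| <= M /\ `|z.2.2| <= M.
Hypothesis S1 : \sum_(z <- S) z.1 = 1.
Hypothesis S0' : forall z, z \in S' -> 0 <= z.1 /\ `|mm z.2| <= M /\ `|cc z.2| <= M.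
Hypothesis S1' : \sum_(z <- S') z.1 <= 1.
Hypothesis SF' : forall q, \sum_(z <- S' | box H q (mm z.2, cc z.2)) z.1 <= L.

Let D (z : R * (R * R)) := \sum_(x <- S) x.1 * osc P (x.2.1 * mm z.2 - x.2.2 - cc z.2).
(** Lipschitz constant times displacement: M H from the slope of the line, H from the height c, and
    h <= H from rounding. *)
Let eps : R := osc_lipc P * ((M + 2) * H).
Let start (a : R) : nat := Num.truncn ((a + W) / h).

Lemma start_itv a : `|a| <= M ->
  a + W - h < h * (start a)%:R <= a + W.
Proof.
rewrite ler_norml => /andP[a1 a2].
have aW : 0 <= (a + W) / h by rewrite divr_ge0 // ?(ltW h0) //; move: VW M0; rewrite /V; lra.
have /andP[t1 t2] := truncn_itv aW.
move: t1 t2; rewrite -/(start a) -natr1 ler_pdivlMr // ltr_pdivrMr // => t1 t2.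
by apply/andP; split; lra.
Qed.

Lemma start_le a : `|a| <= M -> (start a + N <= 2 * J)%N.
Proof.
move=> aM; have /andP[_ s2] := start_itv aM; move: aM; rewrite ler_norml => /andP[a1 a2].
rewrite -(ler_nat R) -(ler_pM2l h0) natrD natrM mulrDr [h * N%:R]mulrC.
have -> : h * (2 * J%:R) = 2 * W by rewrite -hJ; ring.
by rewrite -/H; move: VW H1; rewrite /V; lra.
Qed.

Lemma window_near a i : `|a| <= M -> (start a <= i < start a + N)%N -> `|g i - a| <= H.
Proof.
move=> aM /andP[i1 i2]; have /andP[s1 s2] := start_itv aM.
have j1 : h * (start a)%:R <= h * i%:R by rewrite ler_pM2l // ler_nat.
have j2 : h * i%:R + h <= h * (start a)%:R + H.
  have -> : h * i%:R + h = h * i.+1%:R by rewrite -natr1; ring.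
  by rewrite /H [_ * h]mulrC -mulrDr -natrD ler_pM2l // ler_nat.
have e : g i = h * i%:R - W by rewrite /g /gridpt -hJ; ring.
have H0 : 0 <= H by rewrite mulr_ge0 // ltW.
have hH : h <= H by rewrite /H ler_peMl ?ler1n // ltW.
by rewrite e ler_norml; apply/andP; split; move: H0 hH j1 j2 s1 s2; lra.
Qed.

Lemma D_near z i j : z \in S' ->
  (start (mm z.2) <= i < start (mm z.2) + N)%N -> (start (cc z.2) <= j < start (cc z.2) + N)%N ->
  D z ^+ 2 - 2 * eps ^+ 2 <= cut V (g i) * (2 * grid_density h J P S i j ^+ 2).
Proof.
move=> /S0'[_ [m1 c1]] /(window_near m1) ni /(window_near c1) nj.
have H0 : 0 <= H by rewrite mulr_ge0 // ltW.
have hH : h <= H by rewrite /H ler_peMl ?ler1n // ltW.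
have cg : 1 <= cut V (g i).
  apply: cut_ge1; move: m1 ni H1; rewrite !ler_norml /V => /andP[? ?] /andP[? ?] ?.
  by apply/andP; split; lra.
have dd : `|D z - grid_density h J P S i j| <= eps.
  rewrite /D /grid_density -sumrB -[eps]mul1r -[X in _ <= X * _]S1 big_distrl /=.
  apply: (le_trans (ler_norm_sum _ _ _)).
  rewrite big_seq [X in _ <= X]big_seq; apply: ler_sum => x /S0[x0 [x1 x2]].
  rewrite -mulrBr normrM ger0_norm //; apply: ler_wpM2l => //.
  apply: (le_trans (osc_lip _ _ P0)); rewrite /eps; apply: ler_wpM2l; first exact: osc_lipc_ge0.
  have hx : `|x.2.1 * (g i - mm z.2)| <= M * H by rewrite normrM ler_pM.
  have := row_roundP J x.2 i h0; rewrite -/g; move: hx nj hH.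
  set f := (row_round _ _ _ _)%:~R.
  rewrite !ler_norml => /andP[? ?] /andP[? ?] ? /andP[? ?].
  by apply/andP; split; lra.
have h3 : D z ^+ 2 - 2 * eps ^+ 2 <= 2 * grid_density h J P S i j ^+ 2.
  move: dd; rewrite ler_norml => /andP[d1 d2].
  have e2 : (D z - grid_density h J P S i j) ^+ 2 <= eps ^+ 2 by nra.
  have : 0 <= (D z - 2 * grid_density h J P S i j) ^+ 2 by rewrite sqr_ge0.
  move: e2; rewrite !expr2; lra.
apply: (le_trans h3); apply: ler_peMl cg.
by apply: mulr_ge0; rewrite ?sqr_ge0.
Qed.

(* The inner sum is Lipschitz, so its square at a point is controlled by an
   average over a box of side H; the price is the density L / H ^ 2 of S'. *)
Lemma local_average :
  \sum_(z <- S') z.1 * D z ^+ 2 <= 2 * eps ^+ 2 + 2 * L / H ^+ 2 *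
    \sum_(0 <= i < 2 * J) h * (cut V (g i) * \sum_(0 <= j < 2 * J) h * grid_density h J P S i j ^+ 2).
Proof.
have N1 : 0 < N%:R :> R by rewrite ltr0n.
have V0 : 0 <= V by rewrite addr_ge0.
set near := fun (z : R * (R * R)) i j => (start (mm z.2) <= i < start (mm z.2) + N)%N &&
  (start (cc z.2) <= j < start (cc z.2) + N)%N.
have key z : z \in S' -> N%:R ^+ 2 * (D z ^+ 2 - 2 * eps ^+ 2) <=
   \sum_(0 <= i < 2 * J) \sum_(0 <= j < 2 * J | near z i j) cut V (g i) * (2 * grid_density h J P S i j ^+ 2).
  move=> zS; have [_ [m1 c1]] := S0' zS.
  have -> : N%:R ^+ 2 * (D z ^+ 2 - 2 * eps ^+ 2) =
    \sum_(start (mm z.2) <= i < start (mm z.2) + N) \sum_(start (cc z.2) <= j < start (cc z.2) + N)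
     (D z ^+ 2 - 2 * eps ^+ 2).
    by rewrite !sumr_const_nat !addKn -[RHS]mulr_natl -(mulr_natl (D z ^+ 2 - _)) expr2 mulrA.
  rewrite (sum_window _ (start_le m1)) big_mkcond /=; apply: ler_sum => i _.
  rewrite /near; case: ifP => wi.
    rewrite (sum_window _ (start_le c1)) /=; apply: ler_sum => j wj.
    exact: D_near.
  by rewrite big_pred0 // => j; rewrite wi.
(* For a fixed node, the points of S' whose windows contain it lie in a box of size H, of mass at
   most L. *)
have sw : \sum_(z <- S') z.1 * (N%:R ^+ 2 * (D z ^+ 2 - 2 * eps ^+ 2)) <=
   \sum_(0 <= i < 2 * J) \sum_(0 <= j < 2 * J) cut V (g i) * (2 * grid_density h J P S i j ^+ 2) * L.
  apply: (@le_trans _ _ (\sum_(z <- S') z.1 * \sum_(0 <= i < 2 * J) \sum_(0 <= j < 2 * J | near z i j) cut V (g i) * (2 * grid_density h J P S i j ^+ 2))).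
    rewrite big_seq [X in _ <= X]big_seq; apply: ler_sum => z zS.
    have [z0 _] := S0' zS; apply: ler_wpM2l => //; exact: key.
  under eq_bigr do rewrite big_distrr /=.
  rewrite exchange_big /=; apply: ler_sum => i _.
  under eq_bigr do rewrite big_distrr big_mkcond /=.
  rewrite exchange_big /=; apply: ler_sum => j _.
  apply: (@le_trans _ _ (cut V (g i) * (2 * grid_density h J P S i j ^+ 2) * \sum_(z <- S' | near z i j) z.1)).
    rewrite big_distrr /= [X in _ <= X]big_mkcond /=; apply: ler_sum => z _.
    by case: ifP => // _; rewrite mulrC.
  apply: ler_wpM2l.
    have /andP[c0 _] := cut_bound (g i) V0.
    by apply: mulr_ge0 => //; apply: mulr_ge0 => //; exact: sqr_ge0.
  apply: le_trans (SF' (g i, g j)).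
  rewrite big_seq_cond [X in _ <= X]big_seq_cond big_mkcond [X in _ <= X]big_mkcond /=.
  apply: ler_sum => z _; case: (boolP (z \in S')) => //= zS.
  have [z0 [m1 c1]] := S0' zS.
  case: ifP => [/andP[wi wj]|_]; last by case: ifP.
  suff -> : box H (g i, g j) (mm z.2, cc z.2) by [].
  by apply/andP; split; rewrite /= distrC; [exact: window_near m1 wi | exact: window_near c1 wj].
have H0 : 0 < H by rewrite mulr_gt0.
have e1 : \sum_(0 <= i < 2 * J) \sum_(0 <= j < 2 * J) cut V (g i) * (2 * grid_density h J P S i j ^+ 2) * L
  = N%:R ^+ 2 * (2 * L / H ^+ 2 *
    \sum_(0 <= i < 2 * J) h * (cut V (g i) * \sum_(0 <= j < 2 * J) h * grid_density h J P S i j ^+ 2)).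
  rewrite mulrA big_distrr /=; apply: eq_bigr => i _.
  rewrite !mulrA big_distrr /=; apply: eq_bigr => j _.
  by rewrite /H; field; rewrite !gt_eqF.
have e2 : \sum_(z <- S') z.1 * (N%:R ^+ 2 * (D z ^+ 2 - 2 * eps ^+ 2)) =
  N%:R ^+ 2 * (\sum_(z <- S') z.1 * D z ^+ 2 - 2 * eps ^+ 2 * \sum_(z <- S') z.1).
  rewrite big_distrr /= -sumrB big_distrr /=; apply: eq_bigr => z _; ring.
move: sw; rewrite e1 e2 ler_pM2l ?exprn_gt0 //.
have : 2 * eps ^+ 2 * \sum_(z <- S') z.1 <= 2 * eps ^+ 2.
  by rewrite ler_piMr // mulr_ge0 // sqr_ge0.
lra.
Qed.

End LocalAverage.

Lemma pow16_le (R : realType) k : ((16^-1 : R) ^+ k) ^+ 2 <= (2^-1) ^+ k.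
Proof.
rewrite -exprM mulnC exprM lerXn2r ?nnegrE ?exprn_ge0 ?invr_ge0 //.
by rewrite expr2; lra.
Qed.

(* At scale 256 ^- k with boxes of side 16 ^- (5 k), the energy is O(64 ^- k) and
   the density of S' costs a factor 32 ^ k. *)
Lemma smoothing_estimate (R : realType) (M C C' : R) : 0 <= M -> 0 <= C -> 0 <= C' ->
  exists2 C5 : R, 0 <= C5 & forall k (S S' : seq (R * (R * R))) (mm cc : R * R -> R),
  (forall z, z \in S -> 0 <= z.1 /\ `|z.2.1| <= M /\ `|z.2.2| <= M) ->
  \sum_(z <- S) z.1 = 1 ->
  (forall l q, (l <= 2 * k)%N ->
    \sum_(z <- S | box ((M + 5) * (16^-1) ^+ l) q z.2) z.1 <= C * (128^-1) ^+ l) ->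
  (forall z, z \in S' -> 0 <= z.1 /\ `|mm z.2| <= M /\ `|cc z.2| <= M) ->
  \sum_(z <- S') z.1 <= 1 ->
  (forall q, \sum_(z <- S' | box ((16^-1) ^+ (5 * k)) q (mm z.2, cc z.2)) z.1
     <= C' * (128^-1) ^+ (5 * k)) ->
  \sum_(z <- S') z.1 * (\sum_(x <- S) x.1 * osc (256 ^+ k) (x.2.1 * mm z.2 - x.2.2 - cc z.2)) ^+ 2
    <= C5 * (2^-1) ^+ k.
Proof.
move=> M0 C0 C0'.
pose V : R := M + 2.
have [w wP] : exists w : nat, 2 * (M * V + M + 2) + V + 1 <= w%:R.
  by exists (Num.truncn (2 * (M * V + M + 2) + V + 1)).+1; apply/ltW/truncnS_gt.
have V0 : 0 <= V by rewrite addr_ge0.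
have MV0 : 0 <= M * V by rewrite mulr_ge0.
have VW : V + 1 <= w%:R by lra.
have MW : 2 * (M * V + M + 2) <= w%:R by lra.
have w0 : 0 <= (w%:R : R) by [].
pose C4 : R := (1536 * w%:R * V + 6) * (1 + 512 * C).
have C40 : 0 <= C4 by rewrite /C4 !mulr_ge0 ?addr_ge0 // !mulr_ge0.
pose c6 : R := 2 * 512 ^+ 2 * (M + 2).
exists (2 * c6 ^+ 2 + 2 * C' * C4 + 1).
  by rewrite addr_ge0 // addr_ge0 //; apply: mulr_ge0; rewrite ?sqr_ge0 // mulr_ge0.
move=> k S S' mm cc S0 S1 SF S0' S1' SF'.
pose P : R := 256 ^+ k.
pose H : R := (16^-1) ^+ (5 * k).
have H0 : 0 < H by rewrite exprn_gt0 // invr_gt0.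
have H1 : H <= 1 by rewrite exprn_ile1 ?invr_ge0 // invf_le1 //; lra.
have P0 : 0 < P by rewrite exprn_gt0.
(* [KK] collects the constants that the mesh must beat. Since h = H / N, enlarging N refines the
   mesh while the window keeps its side H. *)
pose KK : R := kernel_c1 w%:R P + 2 * P + 2 * C' * 32 ^+ k * kernel_c3 M V w%:R P * 2 ^+ k.
have K10 : 0 <= kernel_c1 w%:R P.
  by apply: mulr_ge0 => //; apply: mulr_ge0; [exact: mulr_ge0 | exact: sqr_ge0].
have enK0 : 0 <= kernel_c3 M V w%:R P by exact: enK_ge0.
have T0 : 0 <= 2 * C' * 32 ^+ k * kernel_c3 M V w%:R P * 2 ^+ k by rewrite !mulr_ge0 // ?exprn_ge0.
have [N NP] : exists N : nat, KK < N%:R.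
  by exists (Num.truncn KK).+1; apply/truncnS_gt.
have N1 : 0 < N%:R :> R by apply: le_lt_trans NP; rewrite !addr_ge0 // mulr_ge0 // ltW.
have N0 : (0 < N)%N by rewrite -(ltr0n R).
pose h : R := H / N%:R.
have h0 : 0 < h by rewrite divr_gt0.
have NH : N%:R * h = H by rewrite /h; field; rewrite gt_eqF.
have Nh : N%:R * h <= 1 by rewrite NH.
have h1 : h <= 1.
  by apply: le_trans Nh; rewrite ler_peMl ?ler1n // ltW.
(* As 1 / H is the integer 16^(5k), the grid has half-width exactly w; this is why [W] is taken to
   be a natural number. *)
pose J := (N * 16 ^ (5 * k) * w)%N.
have hJ : h * J%:R = w%:R.
  rewrite /J !natrM natrX mulrA mulrA [h * _]mulrC NH /H exprVn mulVf ?mul1r //.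
  by rewrite expf_neq0 // pnatr_eq0.
have small (x : R) : 0 <= x -> x <= KK -> x * h <= 1.
  move=> x0 xK; apply: le_trans Nh; rewrite ler_pM2r //; apply: ltW; apply: le_lt_trans NP; exact: xK.
have hK : kernel_c1 w%:R P * h <= 1.
  by apply: small => //; rewrite /KK -addrA lerDl addr_ge0 // mulr_ge0 // ltW.
have hP : 2 * P * h <= 1.
  by apply: small; [rewrite mulr_ge0 // ltW | rewrite /KK addrAC lerDr addr_ge0].
have hT : 2 * C' * 32 ^+ k * kernel_c3 M V w%:R P * 2 ^+ k * h <= 1.
  by apply: small => //; rewrite /KK lerDr addr_ge0 // mulr_ge0 // ltW.
have e5 : M + 5 = V + 3 by rewrite /V; ring.
have en := energy M0 V0 VW MW h0 h1 hJ hK hP S0 S1 (C := C).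
rewrite -e5 in en; have {}en := en SF.
have la := @local_average R M w%:R h P J N (ltW P0) M0 VW h0 N0 Nh hJ S S' mm cc
  (C' * (128^-1) ^+ (5 * k)) S0 S1 S0' S1'.
rewrite NH in la; have {}la := la SF'.
apply: (le_trans la).
have eP2 : P ^+ 2 * H <= (16^-1) ^+ k.
  have -> : P ^+ 2 * H = (16^-1) ^+ k.
    rewrite /P /H -exprM mulnC exprM [(16^-1) ^+ (5 * k)]exprM -exprMn.
    by congr (_ ^+ _); field.
  by [].
have p2 : 0 <= (2^-1 : R) ^+ k by rewrite exprn_ge0 // invr_ge0.
have p16 : 0 <= (16^-1 : R) ^+ k by rewrite exprn_ge0 // invr_ge0.
have le16 := pow16_le R k.
have ee : (osc_lipc P * ((M + 2) * H)) ^+ 2 <= c6 ^+ 2 * (2^-1) ^+ k.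
  have -> : osc_lipc P * ((M + 2) * H) = c6 * (P ^+ 2 * H) by rewrite /c6 /osc_lipc; ring.
  rewrite exprMn; apply: ler_wpM2l; first exact: sqr_ge0.
  have PH0 : 0 <= P ^+ 2 * H by apply: mulr_ge0; [exact: sqr_ge0 | exact: ltW].
  by apply: le_trans le16; rewrite lerXn2r ?nnegrE.
have eL : 2 * (C' * (128^-1) ^+ (5 * k)) / H ^+ 2 = 2 * C' * 32 ^+ k.
  rewrite /H -!exprM.
  have -> : ((128^-1 : R)) ^+ (5 * k) = (128^-1 ^+ 5) ^+ k by rewrite exprM.
  have -> : ((16^-1 : R)) ^+ (5 * k * 2) = (16^-1 ^+ 10) ^+ k by rewrite -exprM mulnAC.
  rewrite -[(16^-1 ^+ 10) ^+ k]invrK -exprVn -mulrA -mulrA invrK -exprMn.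
  by rewrite mulrA; congr (_ * _ ^+ _); field.
rewrite eL.
set E := \sum_(0 <= i < _) _ in en *.
have L0 : 0 <= 2 * C' * 32 ^+ k by rewrite !mulr_ge0 // exprn_ge0.
have hE := ler_wpM2l L0 en; rewrite -/C4 mulrDr in hE.
have eE : 2 * C' * 32 ^+ k * (C4 * 64^-1 ^+ k) = 2 * C' * C4 * (2^-1) ^+ k.
  have -> : (2^-1 : R) ^+ k = 32 ^+ k * (64^-1) ^+ k by rewrite -exprMn; congr (_ ^+ _); field.
  ring.
rewrite eE in hE.
have hK3 : 2 * C' * 32 ^+ k * (kernel_c3 M V w%:R P * h) <= (2^-1) ^+ k.
  rewrite -[_ <= _]mul1r exprVn -[X in _ <= X]mul1r ler_pdivlMr ?exprn_gt0 //.
  by move: hT; apply: le_trans; rewrite le_eqVlt; apply/orP; left; apply/eqP; ring.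
have -> : (2 * c6 ^+ 2 + 2 * C' * C4 + 1) * (2^-1) ^+ k =
  2 * (c6 ^+ 2 * (2^-1) ^+ k) + (2 * C' * C4 * (2^-1) ^+ k + (2^-1) ^+ k) by ring.
apply: lerD; first by rewrite ler_pM2l.
by apply: (le_trans hE); rewrite lerD2l.
Qed.

(** * Weighted point sets on a tree *)

Section Tree.
Variables (R : realType) (T I : eqType) (E : T -> Prop) (idx : nat -> T -> I).
Variables (children : I -> seq I) (cap : nat -> R).
Hypothesis children_uniq : forall i, uniq (children i).
Hypothesis childrenP : forall l p i, (idx l.+1 p \in children i) = (idx l p == i).
Hypothesis cap_gt0 : forall l, 0 < cap l.

Lemma idx_refine l p q : idx l.+1 p = idx l.+1 q -> idx l p = idx l q.
Proof. by move=> e; apply/eqP; rewrite -childrenP e childrenP. Qed.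

Lemma idx_refine_le l m p q : (l <= m)%N -> idx m p = idx m q -> idx l p = idx l q.
Proof.
move=> /subnKC <-; elim: (m - l)%N => [|d IH]; first by rewrite addn0.
by rewrite addnS => /idx_refine.
Qed.

Definition mass (S : seq (R * T)) (Q : pred T) : R := \sum_(z <- S | Q z.2) z.1.

(* Max-flow min-cut on a tree: the cover shows that the mass is maximal. *)
Definition tree_measure d l i (S : seq (R * T)) (cover : seq (nat * I)) :=
  [/\ forall z, z \in S -> [/\ 0 <= z.1, E z.2 & idx l z.2 = i],
      forall m j, (l <= m <= l + d)%N -> mass S (fun p => idx m p == j) <= cap m,
      forall p, E p -> idx l p = i -> exists2 c, c \in cover & idx c.1 p = c.2 &
      \sum_(c <- cover) cap c.1 <= \sum_(z <- S) z.1].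

Lemma mass_le_total S Q : (forall z, z \in S -> 0 <= z.1) -> mass S Q <= \sum_(z <- S) z.1.
Proof.
move=> S0; rewrite /mass big_mkcond big_seq [X in _ <= X]big_seq /=.
by apply: ler_sum => z /S0; case: ifP.
Qed.

(** The solutions for the children are merged. If their total respects [cap l], the covers are
    merged too; otherwise scaling down saturates the root, which becomes a cover by itself. *)
Lemma tree_measure_exists d l i : exists S cover, tree_measure d l i S cover.
Proof.
elim: d l i => [|d IH] l i.
  have [[p [Ep pi]]|none] := pselect (exists p, E p /\ idx l p = i).
    exists [:: (cap l, p)], [:: (l, i)]; split.
    - by move=> z; rewrite inE => /eqP -> /=; rewrite ltW.
    - move=> m j; rewrite addn0 -eqn_leq => /eqP <-.
      by rewrite /mass big_mkcond big_seq1; case: ifP => // _; exact: ltW.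
    - by move=> q Eq qi; exists (l, i); rewrite ?inE.
    - by rewrite !big_seq1.
  exists [::], [::]; split => //.
  - by move=> m j _; rewrite /mass big_nil ltW.
  - by move=> p Ep pi; case: none; exists p.
  - by rewrite !big_nil.
have /choice[F FP] : forall j, exists SC, tree_measure d l.+1 j SC.1 SC.2.
  by move=> j; have [S [C ?]] := IH l.+1 j; exists (S, C).
pose S0 := flatten [seq (F j).1 | j <- children i].
have S0P z : z \in S0 -> [/\ 0 <= z.1, E z.2 & idx l z.2 = i].
  move=> /flatten_mapP[j jc zj].
  have [/(_ _ zj)[z0 zE zi] _ _ _] := FP j; split=> //.
  by apply/eqP; rewrite -childrenP zi.
have S0pos z : z \in S0 -> 0 <= z.1 by case/S0P.
have S0cap m j : (l < m <= l + d.+1)%N -> mass S0 (fun p => idx m p == j) <= cap m.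
  move=> /andP[lm md].
  have -> : mass S0 (fun p => idx m p == j) =
      \sum_(j' <- children i) mass (F j').1 (fun p => idx m p == j).
    by rewrite /mass big_flatten big_map.
  have fle j' : mass (F j').1 (fun p => idx m p == j) <= cap m.
    by have [_ Fcap _ _] := FP j'; apply: Fcap; rewrite lm addSnnS md.
  (* Points with the same index at level m have the same ancestor at level l + 1, so at most one
     child contributes. *)
  have [[j0 [j0c [z0 [z0F z0m]]]]|none] := pselect (exists j0, j0 \in children i /\
      exists z, z \in (F j0).1 /\ idx m z.2 = j).
    rewrite (bigD1_seq j0) //= big_seq_cond big1 ?addr0 // => j' /andP[_ jj'].
    rewrite /mass big_seq_cond big1 // => z /andP[zF /eqP zm].
    case/eqP: jj'; have [/(_ _ zF)[_ _ <-] _ _ _] := FP j'.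
    have [/(_ _ z0F)[_ _ <-] _ _ _] := FP j0.
    by apply: (idx_refine_le lm); rewrite z0m.
  rewrite big_seq big1 ?ltW // => j' j'c; rewrite /mass big_seq_cond big1 // => z /andP[zF /eqP zm].
  by case: none; exists j'; split=> //; exists z.
have [small|big] := leP (\sum_(z <- S0) z.1) (cap l).
  exists S0, (flatten [seq (F j).2 | j <- children i]); split => //.
  - move=> m j /andP[lm md]; move: lm; rewrite leq_eqVlt => /orP[/eqP <-|lm].
      by apply: le_trans small; apply: mass_le_total.
    by apply: S0cap; rewrite lm.
  - move=> p Ep pi; have [_ _ /(_ p Ep erefl)[c cF cp] _] := FP (idx l.+1 p).
    exists c => //; apply/flatten_mapP; exists (idx l.+1 p) => //.
    by rewrite childrenP pi.
  - rewrite big_flatten /= big_map /S0 big_flatten /= big_map.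
    by apply: ler_sum => j _; have [] := FP j.
set t := \sum_(z <- S0) z.1 in big.
have t0 : 0 < t by apply: lt_trans big.
have c0 : 0 <= cap l / t by rewrite divr_ge0 // ltW.
have c1 : cap l / t <= 1 by rewrite ler_pdivrMr // mul1r ltW.
have scale Q : mass [seq (cap l / t * z.1, z.2) | z <- S0] Q = cap l / t * mass S0 Q.
  by rewrite /mass big_map /= big_distrr.
exists [seq (cap l / t * z.1, z.2) | z <- S0], [:: (l, i)]; split.
- move=> _ /mapP[z zS ->] /=; have [z0 zE zi] := S0P z zS; split=> //; exact: mulr_ge0.
- move=> m j /andP[lm md]; rewrite scale.
  have m0 : 0 <= mass S0 (fun p => idx m p == j).
    by rewrite /mass big_seq_cond; apply: sumr_ge0 => z /andP[/S0pos].
  move: lm; rewrite leq_eqVlt => /orP[/eqP <-|lm].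
    rewrite -[X in _ <= X](divfK (lt0r_neq0 t0)); apply: ler_wpM2l => //.
    exact: mass_le_total.
  apply: (@le_trans _ _ (mass S0 (fun p => idx m p == j))); first by rewrite ler_piMl.
  by apply: S0cap; rewrite lm.
- by move=> p Ep pi; exists (l, i); rewrite ?inE.
- rewrite big_seq1 big_map /= -big_distrr /= -/t divfK //; exact: lt0r_neq0.
Qed.

End Tree.

(** * Densities of determinants *)

Lemma pigeonhole (T : eqType) (G : seq T) (P : T -> nat -> Prop) n0 :
  (forall n, (n0 <= n)%N -> exists2 g, g \in G & P g n) ->
  exists2 g, g \in G & forall N, exists2 n, (N <= n)%N & P g n.
Proof.
elim: G n0 => [|g G IH] n0 h; first by have [] := h n0 (leqnn _).
have [inf|/existsNP[N hN]] := pselect (forall N, exists2 n, (N <= n)%N & P g n).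
  by exists g; rewrite ?mem_head.
have [n|g' g'G hg'] := IH (maxn n0 N).
  rewrite geq_max => /andP[n0n Nn]; have [g' ] := h n n0n.
  rewrite inE => /orP[/eqP -> Pgn|g'G Pg'n]; last by exists g'.
  by case: hN; exists n.
by exists g' => //; rewrite inE g'G orbT.
Qed.

Section Tube.
Variable R : realType.
Implicit Types (S : seq (R * (R * R))) (T : pred (R * R)) (f : R * R -> R).

(** On [T] the value of [f] locates a point up to a box. Cutting the range of [f] into O(16^l) cells
    covers [T] by as many boxes of mass O(128^-l), and 16 / 128 = 1 / 8: exponents above 1 do not
    charge lines. *)
Lemma tube_mass S T f (F A C : R) l :
  (forall z, z \in S -> 0 <= z.1 /\ `|f z.2| <= F) ->
  (forall z z', z \in S -> z' \in S -> T z.2 -> T z'.2 ->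
     `|f z.2 - f z'.2| <= (16^-1) ^+ l -> box (A * (16^-1) ^+ l) z.2 z'.2) ->
  (forall q, \sum_(z <- S | box (A * (16^-1) ^+ l) q z.2) z.1 <= C * (128^-1) ^+ l) ->
  0 <= F -> 0 <= C ->
  \sum_(z <- S | T z.2) z.1 <= (2 * F + 1) * C * (8^-1) ^+ l.
Proof.
move=> S0 TA Sbox F0 C0.
have p16 : 0 < (16 : R) ^+ l by rewrite exprn_gt0.
pose cell p := Num.truncn ((f p + F) * 16 ^+ l).
pose N := (Num.truncn (2 * F * 16 ^+ l)).+1.
have cellP z : z \in S -> (cell z.2)%:R <= (f z.2 + F) * 16 ^+ l < (cell z.2).+1%:R.
  move=> /S0[_]; rewrite ler_norml => /andP[f1 f2].
  by apply: truncn_itv; rewrite mulr_ge0 ?(ltW p16) //; lra.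
have cellN z : z \in S -> (cell z.2 < N)%N.
  move=> zS; have /andP[c1 _] := cellP z zS.
  rewrite ltnS /cell; apply: le_truncn; rewrite ler_pM2r //.
  by have [_] := S0 z zS; rewrite ler_norml => /andP[f1 f2]; lra.
have -> : \sum_(z <- S | T z.2) z.1 = \sum_(0 <= j < N) \sum_(z <- S | T z.2 && (cell z.2 == j)) z.1.
  under [RHS]eq_bigr do rewrite big_mkcond /=.
  rewrite exchange_big /= big_mkcond big_seq [RHS]big_seq /=; apply: eq_bigr => z zS.
  case: ifP => Tz /=; last by rewrite big1.
  rewrite -big_mkcond /= big_mkord.
  by rewrite (big_pred1 (Ordinal (cellN z zS))).
apply: (@le_trans _ _ (\sum_(0 <= j < N) C * (128^-1) ^+ l)).
  apply: ler_sum => j _.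
  have [[z0 [z0S [Tz0 /eqP cz0]]]|none] := pselect (exists z0, z0 \in S /\ T z0.2 /\ cell z0.2 == j); last first.
    rewrite big_seq_cond big1; first by rewrite mulr_ge0 // exprn_ge0 // invr_ge0.
    by move=> z /andP[zS /andP[Tz cz]]; case: none; exists z.
  apply: le_trans (Sbox z0.2).
  rewrite big_mkcond [X in _ <= X]big_mkcond big_seq [X in _ <= X]big_seq /=.
  apply: ler_sum => z zS; have [z0' _] := S0 z zS.
  case: ifP => [/andP[Tz /eqP cz]|_]; last by case: ifP.
  suff -> : box (A * (16^-1) ^+ l) z0.2 z.2 by [].
  apply: TA => //.
  have /andP[a1 a2] := cellP z zS; have /andP[b1 b2] := cellP z0 z0S.
  have e1 : j.+1%:R = j%:R + 1 :> R by rewrite natr1.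
  move: a1 a2 b1 b2; rewrite cz cz0 e1 => a1 a2 b1 b2.
  have : `|(f z0.2 - f z.2) * 16 ^+ l| <= 1 by rewrite ler_norml; apply/andP; split; lra.
  by rewrite normrM (gtr0_norm p16) => h; rewrite exprVn -div1r ler_pdivlMr.
rewrite sumr_const_nat subn0 -(mulr_natr (C * _)).
have N1 : N%:R <= (2 * F + 1) * 16 ^+ l :> R.
  have h : (Num.truncn (2 * F * 16 ^+ l))%:R <= 2 * F * 16 ^+ l :> R.
    by have /andP[] := @truncn_itv R (2 * F * 16 ^+ l) (mulr_ge0 (mulr_ge0 (ler0n _ 2) F0) (ltW p16)).
  rewrite /N -natr1; have : 1 <= (16 : R) ^+ l by rewrite exprn_ege1 //; lra.
  lra.
have e8 : (8^-1 : R) ^+ l = 16 ^+ l * (128^-1) ^+ l.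
  by rewrite -exprMn; congr (_ ^+ _); field.
have c128 : 0 <= C * (128^-1 : R) ^+ l by rewrite mulr_ge0 // exprn_ge0 // invr_ge0.
apply: (le_trans (ler_wpM2l c128 N1)).
by rewrite e8 le_eqVlt; apply/orP; left; apply/eqP; ring.
Qed.

End Tube.

Section Smoothing.
Variable R : realType.
Implicit Types (S Y : seq (R * (R * R))).

(* In the coordinates (y2 / y1, 1 / y1) the condition [det2 x y = s] is affine:
   det2 x y - s = y1 (x1 (y2 / y1) - x2 - s / y1). Meaningless for y1 = 0; only
   points with |y1| bounded below are used. *)
Definition density P S (s : R) (y : R * R) : R :=
  \sum_(x <- S) x.1 * bump P (x.2.1 * (y.2 / y.1) - x.2.2 - s / y.1).

Lemma density_osc k S s y : density (256 ^+ k.+1) S s y - density (256 ^+ k) S s y =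
  \sum_(x <- S) x.1 * osc (256 ^+ k) (x.2.1 * (y.2 / y.1) - x.2.2 - s / y.1).
Proof. by rewrite /density -sumrB; apply: eq_bigr => x _; rewrite /osc -exprS; ring. Qed.

(* Downward induction on k with (a + b) ^ 2 <= 4 a ^ 2 + (4 / 3) b ^ 2. *)
Lemma density_telescope S Y s (C : R) K k : 0 <= C -> (k <= K)%N ->
  (forall z, z \in Y -> 0 <= z.1) ->
  (forall j, (j < K)%N -> \sum_(y <- Y) y.1 * (density (256 ^+ j.+1) S s y.2 - density (256 ^+ j) S s y.2) ^+ 2
     <= C * (2^-1) ^+ j) ->
  \sum_(y <- Y) y.1 * (density (256 ^+ K) S s y.2 - density (256 ^+ k) S s y.2) ^+ 2 <= 12 * C * (2^-1) ^+ k.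
Proof.
move=> C0 kK Y0 hj; move: kK => /subKn; move: (K - k)%N => d <-.
elim: d => [|d IH].
  rewrite subn0 big1 => [|y _]; last by rewrite subrr expr0n mulr0.
  by rewrite !mulr_ge0 // exprn_ge0 // invr_ge0.
have [Kd|dK] := leqP K d.
  by move: IH; have -> : (K - d.+1 = K - d)%N by lia.
have e : (K - d = (K - d.+1).+1)%N by lia.
have jK : (K - d.+1 < K)%N by lia.
move: IH; rewrite e; move: (K - d.+1)%N jK => j jK IH.
apply: (@le_trans _ _ (4 * (\sum_(y <- Y) y.1 * (density (256 ^+ j.+1) S s y.2 - density (256 ^+ j) S s y.2) ^+ 2)
   + 4 / 3 * (\sum_(y <- Y) y.1 * (density (256 ^+ K) S s y.2 - density (256 ^+ j.+1) S s y.2) ^+ 2))).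
  rewrite !big_distrr -big_split /= big_seq [X in _ <= X]big_seq; apply: ler_sum => y /Y0 y0.
  set a := density _ _ _ _; set b := density _ _ _ _; set c := density _ _ _ _.
  have -> : 4 * (y.1 * (c - b) ^+ 2) + 4 / 3 * (y.1 * (a - c) ^+ 2) =
    y.1 * (4 * (c - b) ^+ 2 + 4 / 3 * (a - c) ^+ 2) by ring.
  apply: ler_wpM2l => //.
  have : 0 <= (3 * (c - b) - (a - c)) ^+ 2 by exact: sqr_ge0.
  rewrite !expr2; lra.
have := hj j jK; move: IH; rewrite [(2^-1) ^+ _]exprS.
have p2 : 0 <= C * (2^-1 : R) ^+ j by rewrite mulr_ge0 // exprn_ge0 // invr_ge0.
lra.
Qed.

Lemma density_det P S (s : R) (y : R * R) : y.1 != 0 ->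
  density P S s y = \sum_(x <- S) x.1 * bump P ((det2 x.2 y - s) / y.1).
Proof.
by move=> y0; apply: eq_bigr => x _; congr (_ * bump P _); rewrite /det2; field.
Qed.

Lemma density_lip P S (s t c : R) (y : R * R) : 0 < c -> c <= `|y.1| -> 0 <= P ->
  (forall x, x \in S -> 0 <= x.1) -> \sum_(x <- S) x.1 = 1 ->
  `|density P S s y - density P S t y| <= 4 * P ^+ 2 / c * `|s - t|.
Proof.
move=> c0 cy P0 S0 S1.
have y0 : 0 < `|y.1| by apply: lt_le_trans cy.
rewrite /density -sumrB; apply: (le_trans (ler_norm_sum _ _ _)).
rewrite -[X in _ <= X]mul1r -[X in _ <= X * _]S1 big_distrl /= big_seq [X in _ <= X]big_seq.
apply: ler_sum => x /S0 x0; rewrite -mulrBr normrM ger0_norm //; apply: ler_wpM2l => //.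
apply: (le_trans (bump_lip _ _ P0)).
rewrite -(mulrA (4 * P ^+ 2)); apply: ler_wpM2l; first by rewrite mulr_ge0 // sqr_ge0.
have -> : x.2.1 * (y.2 / y.1) - x.2.2 - s / y.1 - (x.2.1 * (y.2 / y.1) - x.2.2 - t / y.1) = (t - s) / y.1 by ring.
rewrite normrM distrC mulrC normfV; apply: ler_wpM2r => //.
by rewrite lef_pV2 ?posrE.
Qed.

(* Cauchy-Schwarz in the form [2ab >= g^2 - 3(a-g)^2 - 3(b-g)^2], which avoids
   norms of sums. *)
Lemma correlation_lower Y (a b g : R * R -> R) (c da db : R) :
  (forall y, y \in Y -> 0 <= y.1) -> \sum_(y <- Y) y.1 <= 1 ->
  0 <= c -> c <= \sum_(y <- Y) y.1 * g y.2 ->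
  \sum_(y <- Y) y.1 * (a y.2 - g y.2) ^+ 2 <= da ->
  \sum_(y <- Y) y.1 * (b y.2 - g y.2) ^+ 2 <= db ->
  c ^+ 2 - 3 * da - 3 * db <= 2 * \sum_(y <- Y) y.1 * (a y.2 * b y.2).
Proof.
move=> Y0 Y1 c0 cg ha hb.
have key : 2 * c * (\sum_(y <- Y) y.1 * g y.2) - c ^+ 2 * (\sum_(y <- Y) y.1)
   - 3 * (\sum_(y <- Y) y.1 * (a y.2 - g y.2) ^+ 2) - 3 * (\sum_(y <- Y) y.1 * (b y.2 - g y.2) ^+ 2)
   <= 2 * \sum_(y <- Y) y.1 * (a y.2 * b y.2).
  rewrite !big_distrr -!sumrB /= big_seq [X in _ <= X]big_seq; apply: ler_sum => y /Y0 y0.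
  set A := a y.2; set B := b y.2; set G := g y.2.
  have -> : 2 * c * (y.1 * G) - c ^+ 2 * y.1 - 3 * (y.1 * (A - G) ^+ 2) - 3 * (y.1 * (B - G) ^+ 2)
    = y.1 * (2 * c * G - c ^+ 2 - 3 * (A - G) ^+ 2 - 3 * (B - G) ^+ 2) by ring.
  have -> : 2 * (y.1 * (A * B)) = y.1 * (2 * (A * B)) by ring.
  apply: ler_wpM2l => //.
  have h1 := sqr_ge0 (c - G); have h2 := sqr_ge0 (A + B - G).
  have h3 := sqr_ge0 (A - G); have h4 := sqr_ge0 (B - G).
  by move: h1 h2 h3 h4; rewrite !expr2; lra.
have c2 : c * c <= c * \sum_(y <- Y) y.1 * g y.2 by rewrite ler_wpM2l.
have c3 : c ^+ 2 * (\sum_(y <- Y) y.1) <= c ^+ 2 by rewrite ler_piMr // sqr_ge0.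
by move: key c2 c3; rewrite !expr2; lra.
Qed.

End Smoothing.

Lemma geometric_small (R : realType) (b K e : R) : 2 <= b -> 0 <= K -> 0 < e ->
  exists l0 : nat, forall l, (l0 <= l)%N -> K * (b^-1) ^+ l <= e.
Proof.
move=> b2 K0 e0; exists (Num.truncn (K / e)).+1 => l hl.
have b0 : 0 < b by lra.
rewrite exprVn ler_pdivrMr ?exprn_gt0 // [e * _]mulrC -ler_pdivrMr //.
apply/ltW; apply: (lt_le_trans (truncnS_gt _)).
apply: (@le_trans _ _ (l%:R)); first by rewrite ler_nat.
apply: (@le_trans _ _ (2 ^+ l)); first by rewrite -natrX ler_nat; apply/ltnW/ltn_expl.
by rewrite lerXn2r ?nnegrE ?(ltW b0).
Qed.

Lemma norm_close (R : realDomainType) (a b q e : R) :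
  `|a - q| <= e -> `|b - q| <= e -> `|a - b| <= 2 * e.
Proof.
by move=> h1 h2; apply: (le_trans (ler_distD q _ _)); rewrite mulr_natl lerD // distrC.
Qed.

(** * Non-degenerate pairs and the decay of density increments *)

Section Core.
Variables (R : realType) (M : R) (S : nat -> seq (R * (R * R))).
Hypothesis M1 : 1 <= M.
Hypothesis S0 : forall n z, z \in S n -> 0 <= z.1 /\ `|z.2.1| <= M /\ `|z.2.2| <= M.
Hypothesis S1 : forall n, \sum_(z <- S n) z.1 = 1.
Hypothesis SF : forall A : R, 0 <= A -> exists2 C : R, 0 <= C & forall n l q, (l <= n)%N ->
  \sum_(z <- S n | box (A * (16^-1) ^+ l) q z.2) z.1 <= C * (128^-1) ^+ l.

Let M0 : 0 <= M. Proof. exact: le_trans M1. Qed.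

(** A thin strip around the second axis and thin tubes around lines through the origin have mass at
    most 1 / 4, and (3 / 4)^2 >= 1 / 2. This keeps both y1 and the determinant away from 0. The
    tubes come second: their boxes depend on [c], since x2 is recovered from x1 by dividing by
    y1. *)
Lemma pairs_mass : exists c c' : R, exists n0, [/\ 0 < c, 0 < c' & forall n, (n0 <= n)%N ->
  2^-1 <= \sum_(y <- S n | c <= `|y.2.1|) y.1 * \sum_(x <- S n | c' <= `|det2 x.2 y.2|) x.1].
Proof.
have M2 : 0 <= 2 * M + 1 by rewrite addr_ge0 // mulr_ge0.
have [C1 C10 F1] := SF ler01.
have e4 : 0 < 4^-1 :> R by rewrite invr_gt0.
have le28 : (2 : R) <= 8 by lra.
have [l1 l1P] := geometric_small le28 (mulr_ge0 M2 C10) e4.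
pose c : R := (16^-1) ^+ l1 / 2.
have c0 : 0 < c by rewrite divr_gt0 // exprn_gt0 // invr_gt0.
pose A : R := (M + 1) / c + 1.
have A0 : 0 <= A by rewrite addr_ge0 // divr_ge0 ?addr_ge0 // ltW.
have [C2 C20 F2] := SF A0.
have [l2 l2P] := geometric_small le28 (mulr_ge0 M2 C20) e4.
pose c' : R := (16^-1) ^+ l2 / 2.
have c0' : 0 < c' by rewrite divr_gt0 // exprn_gt0 // invr_gt0.
exists c, c', (maxn l1 l2); split=> // n; rewrite geq_max => /andP[n1 n2].
have strip : \sum_(y <- S n | `|y.2.1| < c) y.1 <= 4^-1.
  apply: le_trans (l1P l1 (leqnn _)).
  apply: (@tube_mass R (S n) (fun p => `|p.1| < c) snd M 1 C1 l1) => //.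
  - by move=> z /S0[z0 [_ z2]].
  - move=> z z' _ _ zc zc' h; apply/andP; split; rewrite mul1r; last by rewrite distrC.
    move: zc zc'; rewrite !ltr_norml ler_norml /c => /andP[? ?] /andP[? ?].
    by apply/andP; split; lra.
  - by move=> q; exact: F1.
have tube y : c <= `|y.2.1| -> y \in S n -> \sum_(x <- S n | `|det2 x.2 y.2| < c') x.1 <= 4^-1.
  move=> yc /S0[_ [y1 y2]].
  apply: le_trans (l2P l2 (leqnn _)).
  apply: (@tube_mass R (S n) (fun p => `|det2 p y.2| < c') fst M A C2 l2) => //.
  - by move=> z /S0[z0 [z1 _]].
  - move=> z z' _ _ zc zc' h.
    have h0 : 0 <= (16^-1 : R) ^+ l2 by rewrite exprn_ge0 // invr_ge0.
    have Ac : 0 <= (M + 1) / c by rewrite divr_ge0 ?addr_ge0 // ltW.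
    rewrite distrC in h.
    have Ah : 0 <= (M + 1) / c * (16^-1) ^+ l2 by rewrite mulr_ge0.
    apply/andP; split; first by apply: (le_trans h); rewrite /A; lra.
    have yn0 : 0 < `|y.2.1| by apply: lt_le_trans yc.
    have e : (z'.2.2 - z.2.2) * y.2.1 = (z'.2.1 - z.2.1) * y.2.2 - det2 z'.2 y.2 + det2 z.2 y.2.
      by rewrite /det2; ring.
    have h3 : `|(z'.2.2 - z.2.2) * y.2.1| <= (M + 1) * (16^-1) ^+ l2.
      have h4 : `|(z'.2.1 - z.2.1) * y.2.2| <= (16^-1) ^+ l2 * M by rewrite normrM ler_pM.
      have -> : (M + 1) * (16^-1) ^+ l2 = (16^-1) ^+ l2 * M + c' + c' by rewrite /c'; field.
      rewrite e; apply: (le_trans (ler_normD _ _)); apply: lerD; last exact: ltW.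
      by apply: (le_trans (ler_normB _ _)); apply: lerD => //; exact: ltW.
    have h5 : `|z'.2.2 - z.2.2| * c <= (M + 1) * (16^-1) ^+ l2.
      by apply: le_trans h3; rewrite normrM ler_wpM2l.
    have : `|z'.2.2 - z.2.2| <= (M + 1) * (16^-1) ^+ l2 / c by rewrite ler_pdivlMr.
    by rewrite /A; lra.
  - by move=> q; exact: F2.
have big1 : 3 / 4 <= \sum_(y <- S n | c <= `|y.2.1|) y.1.
  have := S1 n; rewrite (bigID (fun y => c <= `|y.2.1|)) /=.
  by under [X in _ + X = _ -> _]eq_bigl do rewrite -ltNge; move: strip; lra.
have big2 y : c <= `|y.2.1| -> y \in S n -> 3 / 4 <= \sum_(x <- S n | c' <= `|det2 x.2 y.2|) x.1.
  move=> yc yS; have := tube y yc yS.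
  have := S1 n; rewrite (bigID (fun x => c' <= `|det2 x.2 y.2|)) /=.
  by under [X in _ + X = _ -> _]eq_bigl do rewrite -ltNge; lra.
apply: (@le_trans _ _ (\sum_(y <- S n | c <= `|y.2.1|) y.1 * (3 / 4))).
  by rewrite -big_distrl /=; lra.
rewrite big_seq_cond [X in _ <= X]big_seq_cond; apply: ler_sum => y /andP[yS yc].
by have [y0 _] := S0 yS; apply: ler_wpM2l => //; exact: big2.
Qed.

(** For |y1| >= c and |s| >= sg the map y -> (y2 / y1, s / y1) has a Lipschitz inverse, so the image
    of [S n] still satisfies the bound on boxes that [smoothing_estimate] requires. *)
Lemma density_rate (c sg B : R) : 0 < c -> 0 < sg -> 0 <= B ->
  exists2 C : R, 0 <= C & forall n k s, (5 * k <= n)%N -> sg <= `|s| -> `|s| <= B ->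
   \sum_(y <- [seq z <- S n | c <= `|z.2.1|])
     y.1 * (density (256 ^+ k.+1) (S n) s y.2 - density (256 ^+ k) (S n) s y.2) ^+ 2 <= C * (2^-1) ^+ k.
Proof.
move=> c0 sg0 B0.
pose M' : R := M + M / c + B / c.
have Mc : 0 <= M / c by rewrite divr_ge0 // ltW.
have Bc : 0 <= B / c by rewrite divr_ge0 // ltW.
have MM' : M <= M' by rewrite /M' -addrA lerDl addr_ge0.
have M0' : 0 <= M' by rewrite !addr_ge0.
have [C1 C10 F1] := SF (addr_ge0 M0' (ler0n _ 5)).
pose A : R := 2 * M + 2 * (M * M / sg) + 2 * (M * M / sg) * (M / c).
have MMs : 0 <= M * M / sg by rewrite divr_ge0 ?mulr_ge0 // ltW.
have MMsc : 0 <= 2 * (M * M / sg) * (M / c).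
  by apply: mulr_ge0 => //; apply: mulr_ge0.
have A0 : 0 <= A by rewrite !addr_ge0 // mulr_ge0.
have [C2 C20 F2] := SF A0.
have [C5 C50 key] := smoothing_estimate M0' C10 C20.
exists C5 => // n k s kn sgs sB.
set Y := [seq z <- S n | _].
have Y0 z : z \in Y -> [/\ z \in S n, c <= `|z.2.1|, 0 <= z.1, `|z.2.1| <= M & `|z.2.2| <= M].
  by rewrite mem_filter => /andP[zc zS]; have [? [? ?]] := S0 zS.
under eq_bigr do rewrite density_osc.
have div_le (a b d : R) : c <= `|d| -> `|a| <= b -> `|a / d| <= b / c.
  move=> cd ab; rewrite normrM normfV; apply: ler_pM => //.
    by rewrite invr_ge0.
  by rewrite lef_pV2 ?posrE // (lt_le_trans c0).
apply: (key k (S n) Y (fun y => y.2 / y.1) (fun y => s / y.1)) => //.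
- by move=> z /S0[z0 [z1 z2]]; split=> //; split; [apply: (le_trans z1) | apply: (le_trans z2)].
- move=> l q lk; apply: F1; apply: leq_trans kn; apply: (leq_trans lk).
  by rewrite leq_mul2r orbT.
- move=> z /Y0[zS zc z0 z1 z2]; split=> //.
  have := div_le _ _ _ zc z2; have := div_le _ _ _ zc sB.
  by move=> h1 h2; split; [apply: (le_trans h2); rewrite /M' addrAC lerDr addr_ge0
    | apply: (le_trans h1); rewrite /M' lerDr addr_ge0].
- rewrite -(S1 n) big_filter; apply: (@mass_le_total R (R * R)%type (S n) (fun p => c <= `|p.1|)) => z.
  by case/S0.
move=> q; set H := (16^-1) ^+ (5 * k).
have H0 : 0 <= H by rewrite exprn_ge0 // invr_ge0.
(* A box that meets the image is recentred at one of its points, which doubles its size; the other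
   boxes have no mass. *)
have [[z0 [z0Y z0b]]|none] := pselect (exists z0, z0 \in Y /\ box H q (z0.2.2 / z0.2.1, s / z0.2.1)); last first.
  rewrite big_seq_cond big1; first by rewrite mulr_ge0 // exprn_ge0 // invr_ge0.
  by move=> z /andP[zY zb]; case: none; exists z.
apply: le_trans (F2 n (5 * k)%N z0.2 kn).
rewrite big_filter_cond big_mkcond [X in _ <= X]big_mkcond big_seq [X in _ <= X]big_seq /=.
apply: ler_sum => z zS; have [zp _] := S0 zS.
case: ifP => [/andP[zc zb]|_]; last by case: ifP.
suff -> : box (A * H) z0.2 z.2 by [].
have zY : z \in Y by rewrite mem_filter zc.
have [_ _ _ z1 z2] := Y0 z zY; have [_ zc0 _ w1 w2] := Y0 z0 z0Y.
move: zb z0b => /andP[/= b1 b2] /andP[/= d1 d2].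
have n1 : z.2.1 != 0 by rewrite -normr_gt0 (lt_le_trans c0).
have n2 : z0.2.1 != 0 by rewrite -normr_gt0 (lt_le_trans c0).
have s0 : 0 < `|s| by apply: lt_le_trans sgs.
have sn0 : s != 0 by rewrite -normr_gt0.
have dm : `|z.2.2 / z.2.1 - z0.2.2 / z0.2.1| <= 2 * H.
  exact: norm_close b1 d1.
have dc : `|s / z.2.1 - s / z0.2.1| <= 2 * H.
  exact: norm_close b2 d2.
have h1 : `|z.2.1 - z0.2.1| <= 2 * (M * M / sg) * H.
  have -> : z.2.1 - z0.2.1 = - (z.2.1 * z0.2.1 / s) * (s / z.2.1 - s / z0.2.1).
    by field; rewrite n1 n2 sn0.
  rewrite normrM normrN normrM normrM normfV.
  have e : 2 * (M * M / sg) * H = M * M / sg * (2 * H) by ring.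
  rewrite e; apply: ler_pM => //; first by rewrite divr_ge0 ?mulr_ge0.
  apply: ler_pM; [by rewrite mulr_ge0 | by rewrite invr_ge0 | exact: ler_pM |].
  by rewrite lef_pV2 ?posrE.
have h2 : `|z.2.2 - z0.2.2| <= 2 * M * H + 2 * (M * M / sg) * (M / c) * H.
  have -> : z.2.2 - z0.2.2 = z.2.1 * (z.2.2 / z.2.1 - z0.2.2 / z0.2.1)
     + (z.2.1 - z0.2.1) * (z0.2.2 / z0.2.1) by field; rewrite n1 n2.
  apply: (le_trans (ler_normD _ _)); apply: lerD; rewrite normrM.
    have -> : 2 * M * H = M * (2 * H) by ring.
    by apply: ler_pM.
  have -> : 2 * (M * M / sg) * (M / c) * H = 2 * (M * M / sg) * H * (M / c) by ring.
  by apply: ler_pM => //; exact: div_le.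
apply/andP; split; [apply: (le_trans h1) | apply: (le_trans h2); rewrite -mulrDl];
  apply: ler_wpM2r => //; rewrite /A.
  by rewrite addrAC lerDr addr_ge0 // mulr_ge0.
by apply: lerD => //; rewrite lerDl; apply: mulr_ge0.
Qed.

End Core.

(** * A lower bound for the density at a coarse scale *)

Lemma exists_large_term (R : realDomainType) (T : eqType) (G : seq T) (F : T -> R) (m : R) :
  0 < m * (size G)%:R -> m * (size G)%:R <= \sum_(g <- G) F g -> exists2 g, g \in G & m <= F g.
Proof.
move=> m0 mF; apply: contrapT => none.
suff : \sum_(g <- G) F g < m * (size G)%:R by rewrite ltNge mF.
have G0 : G != [::] by apply: contraTneq m0 => ->; rewrite mulr0 ltxx.
rewrite mulr_natr -iter_addr_0 -(count_predT G) -big_const_seq.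
rewrite big_seq [X in _ < X]big_seq; apply: ltr_sum.
  by case: G G0 {none m0 mF} => // g G _; rewrite /= mem_head.
by move=> g gG; rewrite ltNge; apply/negP => mg; apply: none; exists g.
Qed.

Section Core.
Variables (R : realType) (M : R) (S : nat -> seq (R * (R * R))).
Hypothesis M1 : 1 <= M.
Hypothesis S0 : forall n z, z \in S n -> 0 <= z.1 /\ `|z.2.1| <= M /\ `|z.2.2| <= M.
Hypothesis S1 : forall n, \sum_(z <- S n) z.1 = 1.

Let M0 : 0 <= M. Proof. exact: le_trans M1. Qed.

Lemma det2_le n x y : x \in S n -> y \in S n -> `|det2 x.2 y.2| <= 2 * M ^+ 2.
Proof.
move=> /S0[_ [x1 x2]] /S0[_ [y1 y2]].
have h1 : `|x.2.1 * y.2.2| <= M * M by rewrite normrM ler_pM.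
have h2 : `|x.2.2 * y.2.1| <= M * M by rewrite normrM ler_pM.
by rewrite /det2; apply: (le_trans (ler_normB _ _)); rewrite expr2; move: h1 h2; lra.
Qed.

(* A grid of step c / (2 P) has O(P) points, which is why the bound does not
   depend on the scale P. *)
Lemma coarse_density (c c' P : R) : 0 < c -> 0 < c' -> 1 <= P -> c / P <= c' ->
  exists2 G : seq R, (forall g, g \in G -> c' / 2 <= `|g| <= 2 * M ^+ 2) &
  forall n, 2^-1 <= \sum_(y <- S n | c <= `|y.2.1|) y.1 *
      \sum_(x <- S n | c' <= `|det2 x.2 y.2|) x.1 ->
    exists2 g, g \in G & (16 * (2 * M ^+ 2) / c + 4)^-1 <=
      \sum_(y <- [seq z <- S n | c <= `|z.2.1|]) y.1 * density P (S n) g y.2.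
Proof.
move=> c0 c0' P1 cP.
have P0 : 0 < P by apply: lt_le_trans P1.
set B := 2 * M ^+ 2.
have B0 : 0 <= B by rewrite mulr_ge0 // sqr_ge0.
(* An error d in s moves the argument of the bump by at most d / c = 1 / (2 P), where the bump is
   still at least P / 2. *)
pose d := c / P / 2.
have d0 : 0 < d by rewrite !divr_gt0.
pose N := (Num.truncn (2 * B / d)).+1.
pose pt j : R := - B + j%:R * d.
pose G := [seq g <- [seq pt j | j <- iota 0 N] | c' / 2 <= `|g|].
have BdN : (Num.truncn (2 * B / d))%:R <= 2 * B / d :> R.
  have BB : 0 <= 2 * B / d by apply: divr_ge0; [exact: mulr_ge0 | exact: ltW].
  by have /andP[] := truncn_itv BB.
exists G.
  move=> g; rewrite mem_filter => /andP[-> /mapP[j]].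
  rewrite mem_iota add0n leq0n andTb => jN ->; rewrite andTb; rewrite /pt ler_norml.
  have jd : j%:R * d <= 2 * B.
    rewrite -ler_pdivlMr //; apply: le_trans BdN; rewrite ler_nat.
    by move: jN; rewrite /N ltnS.
  have jd0 : 0 <= j%:R * d by rewrite mulr_ge0 // ltW.
  by apply/andP; split; lra.
move=> n hn; set Y := [seq z <- S n | _].
have Y0 z : z \in Y -> [/\ z \in S n, c <= `|z.2.1| & 0 <= z.1].
  by rewrite mem_filter => /andP[zc zS]; have [? [? ?]] := S0 zS.
have near v : `|v| <= B -> c' <= `|v| -> exists2 g, g \in G & `|v - g| <= d.
  move=> vB vc; pose j := Num.truncn ((v + B) / d).
  have vB0 : 0 <= (v + B) / d.
    by rewrite divr_ge0 ?(ltW d0) //; move: vB; rewrite ler_norml => /andP[? ?]; lra.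
  have /andP[j1 j2] := truncn_itv vB0.
  have e1 : j.+1%:R = j%:R + 1 :> R by rewrite natr1.
  move: j1 j2; rewrite -/j e1 ler_pdivlMr // ltr_pdivrMr // => j1 j2.
  have vg : `|v - pt j| <= d by rewrite /pt ler_norml; apply/andP; split; lra.
  exists (pt j) => //; rewrite mem_filter; apply/andP; split.
    have d2 : d <= c' / 2 by rewrite /d ler_pM2r ?invr_gt0.
    by have := ler_normD (v - pt j) (pt j); rewrite subrK; lra.
  apply/mapP; exists j => //; rewrite mem_iota /= add0n /N ltnS; apply: le_truncn.
  rewrite ler_pM2r ?invr_gt0 //; move: vB; rewrite ler_norml => /andP[? ?]; lra.
have sizeG : (size G)%:R <= 4 * B / c * P + 1 :> R.
  apply: (@le_trans _ _ N%:R).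
    by rewrite ler_nat; apply: (leq_trans (size_subseq (filter_subseq _ _))); rewrite size_map size_iota.
  rewrite /N -[X in X <= _]natr1 lerD2r; apply: (le_trans BdN).
  rewrite /d le_eqVlt; apply/orP; left; apply/eqP; field.
  by rewrite !gt_eqF.
(* Each non-degenerate pair has a nearby grid point, which contributes P / 2 times its weight, and
   these pairs have mass at least 1 / 2. *)
have total : P / 4 <= \sum_(g <- G) \sum_(y <- Y) y.1 * density P (S n) g y.2.
  rewrite exchange_big /=.
  have -> : P / 4 = P / 2 * 2^-1 by field.
  have P2 : 0 <= P / 2 by rewrite divr_ge0 // ltW.
  apply: (le_trans (ler_wpM2l P2 hn)).
  rewrite big_distrr -big_filter -/Y /= big_seq [X in _ <= X]big_seq.
  apply: ler_sum => y yY; have [yS yc y0] := Y0 y yY.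
  rewrite -big_distrr /= mulrCA; apply: ler_wpM2l => //.
  have yn : y.2.1 != 0 by rewrite -normr_gt0 (lt_le_trans c0).
  rewrite /density exchange_big /= big_distrr /= big_mkcond big_seq [X in _ <= X]big_seq /=.
  apply: ler_sum => x xS; have [x0 _] := S0 xS.
  have b0 g : 0 <= x.1 * bump P (x.2.1 * (y.2.2 / y.2.1) - x.2.2 - g / y.2.1).
    by rewrite mulr_ge0 //; have /andP[] := @bump_bound R P (x.2.1 * (y.2.2 / y.2.1) - x.2.2 - g / y.2.1) (ltW P0).
  case: ifP => xc; last by apply: sumr_ge0 => g _.
  have [g gG vg] := near _ (det2_le xS yS) xc.
  rewrite (perm_big _ (perm_to_rem gG)) big_cons /=.
  apply: (@le_trans _ _ (x.1 * bump P (x.2.1 * (y.2.2 / y.2.1) - x.2.2 - g / y.2.1))); last first.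
    by rewrite lerDl; apply: sumr_ge0 => g' _.
  rewrite mulrC; apply: ler_wpM2l => //; apply: bump_half => //.
  have -> : x.2.1 * (y.2.2 / y.2.1) - x.2.2 - g / y.2.1 = (det2 x.2 y.2 - g) / y.2.1.
    by rewrite /det2; field.
  rewrite normrM normfV ler_pdivrMr ?normr_gt0 //; apply: (le_trans vg).
  have -> : d = 2^-1 / P * c by rewrite /d; field; rewrite gt_eqF.
  by rewrite ler_pM2l // mulr_gt0 // invr_gt0.
have K0 : 0 < 16 * B / c + 4.
  have h : 0 <= 16 * B / c by apply: divr_ge0; [exact: mulr_ge0 | exact: ltW].
  by lra.
have Bc0 : 0 <= B / c by rewrite divr_ge0 // ltW.
have sz : (16 * B / c + 4)^-1 * (size G)%:R <= P / 4.
  rewrite mulrC ler_pdivrMr //; apply: (le_trans sizeG).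
  have BcP : 0 <= B / c * (P - 1) by rewrite mulr_ge0 // subr_ge0.
  have -> : P / 4 * (16 * B / c + 4) = 4 * B / c * P + P by field; rewrite gt_eqF.
  by rewrite lerD2l.
have G1 : (0 < size G)%N.
  rewrite lt0n; apply/negP => /eqP/size0nil G0.
  by move: total; rewrite G0 big_nil; have := P0; lra.
apply: exists_large_term; last exact: le_trans total.
by rewrite mulr_gt0 ?invr_gt0 // ltr0n.
Qed.

End Core.

(** * Positive correlation at all fine scales *)

Lemma sum_neq0_exists (R : nmodType) (T : eqType) (G : seq T) (F : T -> R) :
  \sum_(g <- G) F g != 0 -> exists2 g, g \in G & F g != 0.
Proof.
move=> h; apply: contrapT => none; move/eqP: h; apply.
rewrite big_seq big1 // => g gG; apply/eqP; apply: contrapT => /negP Fg.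
by apply: none; exists g.
Qed.

Lemma sqr_dist_le (R : realDomainType) (a b d : R) :
  (a - b) ^+ 2 <= 2 * (a - d) ^+ 2 + 2 * (d - b) ^+ 2.
Proof. by have := sqr_ge0 (a - d - (d - b)); rewrite !expr2; lra. Qed.

Lemma norm_between (R : realFieldType) (u g r a b : R) :
  `|u - g| < r -> a <= `|g| <= b -> a - r <= `|u| <= b + r.
Proof.
move=> ug /andP[ag gb]; have := lerB_dist g u; have := lerB_dist u g.
by rewrite [`|g - u|]distrC => h1 h2; apply/andP; split; lra.
Qed.

(** Each deviation combines 12 d, from telescoping, and (c / 8)^2, from moving s at the coarse
    scale. The total loss is 144 d + 3 c^2 / 16, at most 7 c^2 / 16. *)
Lemma correlation_gt0 (R : realFieldType) (c d X : R) :
  0 < c -> 144 * d <= c ^+ 2 / 4 ->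
  c ^+ 2 - 3 * (2 * (12 * d) + 2 * (c / 8) ^+ 2) - 3 * (2 * (12 * d) + 2 * (c / 8) ^+ 2) <= 2 * X ->
  0 < X.
Proof.
move=> c0; have : 0 < c * c by rewrite mulr_gt0.
by rewrite !expr2; lra.
Qed.

Section Core.
Variables (R : realType) (M : R) (S : nat -> seq (R * (R * R))).
Hypothesis M1 : 1 <= M.
Hypothesis S0 : forall n z, z \in S n -> 0 <= z.1 /\ `|z.2.1| <= M /\ `|z.2.2| <= M.
Hypothesis S1 : forall n, \sum_(z <- S n) z.1 = 1.
Hypothesis SF : forall A : R, 0 <= A -> exists2 C : R, 0 <= C & forall n l q, (l <= n)%N ->
  \sum_(z <- S n | box (A * (16^-1) ^+ l) q z.2) z.1 <= C * (128^-1) ^+ l.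

Lemma density_support P n s (y : R * (R * R)) : 0 < P -> `|y.2.1| <= M -> y.2.1 != 0 ->
  density P (S n) s y.2 != 0 -> exists2 x, x \in S n & `|det2 x.2 y.2 - s| <= M * P^-1.
Proof.
move=> P0 yM yn; rewrite density_det // => /sum_neq0_exists[x xS].
rewrite mulf_eq0 negb_or => /andP[_ bn]; exists x => //.
have [far|near] := leP P^-1 `|(det2 x.2 y.2 - s) / y.2.1|.
  by rewrite bump_out // eqxx in bn.
move: near; rewrite normrM normfV ltr_pdivrMr ?normr_gt0 // => /ltW near.
apply: (le_trans near); rewrite mulrC; apply: ler_wpM2r => //.
by rewrite invr_ge0 ltW.
Qed.

Lemma dense_ball : exists s0 r : R, [/\ 0 < r, r <= `|s0| / 2 &
  forall s t e, `|s - s0| < r -> `|t - s0| < r -> 0 < e ->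
  exists n x y z, [/\ x \in S n, y \in S n, z \in S n,
    `|det2 x.2 y.2 - s| < e & `|det2 z.2 y.2 - t| < e]].
Proof.
have M0 : 0 <= M by apply: le_trans M1.
have [c [c' [n0 [c0 c0' pm]]]] := pairs_mass M1 S0 S1 SF.
pose B : R := 2 * M ^+ 2.
have B0 : 0 <= B by rewrite mulr_ge0 // sqr_ge0.
have sg0 : 0 < c' / 4 by rewrite divr_gt0.
have [C C0 rate] := density_rate M1 S0 S1 SF c0 sg0 (addr_ge0 B0 ler01).
pose c1 : R := (16 * B / c + 4)^-1.
have c10 : 0 < c1.
  have h : 0 <= 16 * B / c by apply: divr_ge0; [exact: mulr_ge0 | exact: ltW].
  by rewrite invr_gt0; lra.
have e10 : 0 < c1 ^+ 2 / 4 by rewrite divr_gt0 // exprn_gt0.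
have C144 : 0 <= 144 * C by rewrite mulr_ge0.
(* The lower bound [c1] is independent of the scale, so the coarse scale can be chosen after it:
   [k1] makes the telescoped tail small against c1^2, [k2] makes c / P at most c'. *)
have [k1 k1P] := geometric_small (lexx 2) C144 e10.
have le256 : 2 <= 256 :> R by lra.
have [k2 k2P] := geometric_small le256 (ltW c0) c0'.
pose k0 := maxn k1 k2.
have {}k1P := k1P k0 (leq_maxl _ _); have {}k2P := k2P k0 (leq_maxr _ _).
pose P : R := 256 ^+ k0.
have P1 : 1 <= P by rewrite exprn_ege1 //; lra.
have P0 : 0 < P by apply: lt_le_trans P1.
have cP : c / P <= c' by rewrite /P -exprVn.
have [G GP dens] := coarse_density S0 c0 c0' P1 cP.
(* Moving s by less than [tau] changes the density at scale P by at most c1 / 8. *)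
pose tau := c1 / 8 / (4 * P ^+ 2 / c).
have PP0 : 0 < 4 * P ^+ 2 / c by rewrite divr_gt0 // mulr_gt0 // exprn_gt0.
have tau0 : 0 < tau by rewrite divr_gt0 // divr_gt0.
pose r := Num.min 1 (Num.min (c' / 4) tau).
have r0 : 0 < r by rewrite !lt_min ltr01 sg0 tau0.
have r1 : r <= 1 by rewrite ge_min lexx.
have r2 : r <= c' / 4 by rewrite !ge_min lexx orbT.
have r3 : r <= tau by rewrite !ge_min lexx !orbT.
(* The index is 5 K because the estimate at scale 256^k uses the mass of boxes down to size
   16^-(5k). *)
pose Q g K := forall s t, `|s - g| < r -> `|t - g| < r -> exists x y z,
  [/\ x \in S (5 * K)%N, y \in S (5 * K)%N, z \in S (5 * K)%N,
    `|det2 x.2 y.2 - s| <= M * (256^-1) ^+ K & `|det2 z.2 y.2 - t| <= M * (256^-1) ^+ K].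
have QK K : (maxn k0 n0 <= K)%N -> exists2 g, g \in G & Q g K.
  rewrite geq_max => /andP[k0K n0K].
  have n0K5 : (n0 <= 5 * K)%N by apply: leq_trans n0K _; rewrite leq_pmull.
  have [g gG hg] := dens _ (pm _ n0K5).
  exists g => // s t sg tg.
  have /andP[g1 g2] := GP g gG.
  set Y := [seq z <- S (5 * K)%N | _] in hg.
  have Y0 y : y \in Y -> [/\ y \in S (5 * K)%N, c <= `|y.2.1|, 0 <= y.1 & `|y.2.1| <= M].
    by rewrite mem_filter => /andP[yc yS]; have [? [? ?]] := S0 yS.
  have Y00 y : y \in Y -> 0 <= y.1 by case/Y0.
  have Y1 : \sum_(y <- Y) y.1 <= 1.
    rewrite -(S1 (5 * K)) big_filter.
    by apply: (@mass_le_total R (R * R)%type _ (fun p => c <= `|p.1|)) => z /S0[].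
  have dev u : `|u - g| < r ->
    \sum_(y <- Y) y.1 * (density (256 ^+ K) (S (5 * K)) u y.2 - density P (S (5 * K)) g y.2) ^+ 2
      <= 2 * (12 * C * (2^-1) ^+ k0) + 2 * (c1 / 8) ^+ 2.
    move=> ug.
    have /andP[u1 u2] := norm_between ug (GP g gG).
    have {}u1 : c' / 4 <= `|u|.
      apply: le_trans u1; have -> : c' / 2 = c' / 4 + c' / 4 by field.
      by rewrite -addrA lerDl subr_ge0.
    have {}u2 : `|u| <= B + 1 by apply: (le_trans u2); rewrite lerD2l.
    have tel : \sum_(y <- Y) y.1 * (density (256 ^+ K) (S (5 * K)) u y.2 - density P (S (5 * K)) u y.2) ^+ 2
       <= 12 * C * (2^-1) ^+ k0.
      apply: density_telescope => // j jK; apply: rate => //.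
      by rewrite leq_mul2l ltnW.
    have lip y : y \in Y -> (density P (S (5 * K)) u y.2 - density P (S (5 * K)) g y.2) ^+ 2 <= (c1 / 8) ^+ 2.
      move=> /Y0[_ yc _ _].
      have hl : `|density P (S (5 * K)) u y.2 - density P (S (5 * K)) g y.2| <= c1 / 8.
        have S00 x : x \in S (5 * K)%N -> 0 <= x.1 by case/S0.
        apply: (le_trans (density_lip u g c0 yc (ltW P0) S00 (S1 _))).
        rewrite mulrC -ler_pdivlMr //; apply: ltW; apply: (lt_le_trans ug); exact: r3.
      by rewrite -[X in X <= _]real_normK ?num_real // lerXn2r ?nnegrE // divr_ge0 // ltW.
    have lip2 : \sum_(y <- Y) y.1 * (density P (S (5 * K)) u y.2 - density P (S (5 * K)) g y.2) ^+ 2 <= (c1 / 8) ^+ 2.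
      apply: (@le_trans _ _ (\sum_(y <- Y) y.1 * (c1 / 8) ^+ 2)).
        rewrite big_seq [X in _ <= X]big_seq; apply: ler_sum => y yY.
        by apply: ler_wpM2l; [exact: Y00 | exact: lip].
      by rewrite -big_distrl /= ler_piMl // sqr_ge0.
    apply: (@le_trans _ _ (2 * \sum_(y <- Y) y.1 * (density (256 ^+ K) (S (5 * K)) u y.2 - density P (S (5 * K)) u y.2) ^+ 2
       + 2 * \sum_(y <- Y) y.1 * (density P (S (5 * K)) u y.2 - density P (S (5 * K)) g y.2) ^+ 2)).
      rewrite !big_distrr -big_split /= big_seq [X in _ <= X]big_seq; apply: ler_sum => y /Y00 y0.
      set a := density _ _ _ _; set b := density _ _ g _; set d := density _ _ _ _.
      have -> : 2 * (y.1 * (a - d) ^+ 2) + 2 * (y.1 * (d - b) ^+ 2) =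
        y.1 * (2 * (a - d) ^+ 2 + 2 * (d - b) ^+ 2) by ring.
      by apply: ler_wpM2l => //; exact: sqr_dist_le.
    by apply: lerD; apply: ler_wpM2l.
  have cor := correlation_lower Y00 Y1 (ltW c10) hg (dev s sg) (dev t tg).
  set X := \sum_(y <- Y) _ in cor.
  have X0 : X != 0.
    by rewrite gt_eqF //; apply: (@correlation_gt0 R c1 (C * (2^-1) ^+ k0)); rewrite ?mulrA in cor *.
  have [y yY] := sum_neq0_exists X0.
  have [yS yc _ yM] := Y0 y yY.
  have yn : y.2.1 != 0 by rewrite -normr_gt0 (lt_le_trans c0).
  rewrite !mulf_eq0 !negb_or => /andP[_ /andP[a0 b0]].
  have PK0 : 0 < (256 : R) ^+ K by apply: exprn_gt0; rewrite ltr0n.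
  have [x xS hx] := density_support PK0 yM yn a0.
  have [z zS hz] := density_support PK0 yM yn b0.
  by exists x, y, z; split=> //; rewrite exprVn.
(* The grid point depends on K, but [G] and [r] do not, so one g serves for arbitrarily large K. *)
have [g gG gP] := pigeonhole QK.
have /andP[g1 _] := GP g gG.
exists g, r; split=> //.
  apply: (le_trans r2); have -> : c' / 4 = c' / 2 / 2 by field.
  by rewrite ler_pM2r ?invr_gt0.
move=> s t e sg tg e0.
have e20 : 0 < e / 2 by rewrite divr_gt0.
have [N NP] := geometric_small le256 M0 e20.
have [K NK QgK] := gP N.
have [x [y [z [xS yS zS hx hz]]]] := QgK s t sg tg.
have {}NP := NP K NK.
have ee : e / 2 < e by rewrite ltr_pdivrMr // ltr_pMr // ltr1n.
by exists (5 * K)%N, x, y, z; split=> //; apply: le_lt_trans ee; apply: le_trans NP.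
Qed.

End Core.

From mathcomp Require Import all_analysis.
Import Defs.
Import numFieldTopology.Exports numFieldNormedType.Exports.
Local Open Scope classical_set_scope.
Local Open Scope ring_scope.

(** * Discrete Frostman measures *)

Section Hausdorff.
Variable R : realType.
Implicit Types (E U : set (R * R)).

Lemma edist_ge0 (p q : R * R) : 0 <= edist p q.
Proof. exact: sqrtr_ge0. Qed.

Lemma diam0 : diam (set0 : set (R * R)) = -oo%E.
Proof.
rewrite /diam (_ : [set _ | _ in _] = set0) ?ereal_sup0 //.
by rewrite -subset0 => x [pq [[]]].
Qed.

Lemma diam_le U (r : R) : (forall p q, U p -> U q -> edist p q <= r) -> (diam U <= r%:E)%E.
Proof.
by move=> h; apply: ge_ereal_sup => x [[p q] [/= Up Uq] <-]; rewrite lee_fin h.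
Qed.

Lemma fine_diam U (r : R) : 0 <= r -> (diam U <= r%:E)%E -> 0 <= fine (diam U) <= r.
Proof.
move=> r0 dr; have [->|/set0P[p Up]] := eqVneq U set0.
  by rewrite diam0 /= lexx.
have d0 : (0%:E <= diam U)%E.
  apply: (@le_trans _ _ (edist p p)%:E); first by rewrite lee_fin edist_ge0.
  by apply: ereal_sup_ubound; exists (p, p).
by move: d0 dr; case: (diam U) => //= x; rewrite !lee_fin => -> ->.
Qed.

Lemma hausdorff_pos E (s : R) : 0 < s -> (s%:E < hausdorff_dim E)%E ->
  exists delta eps : R, [/\ 0 < delta, 0 < eps &
   forall (X : eqType) (cov : seq X) (U : X -> set (R * R)) (r : X -> R),
    (forall c, c \in cov -> 0 <= r c <= delta) ->
    (forall c p q, c \in cov -> U c p -> U c q -> edist p q <= r c) ->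
    (forall p, E p -> exists2 c, c \in cov & U c p) ->
    eps <= \sum_(c <- cov) r c `^ s].
Proof.
move=> s0 dimE.
have hd0 d : (0%E <= hausdorff_delta s d E)%E.
  apply: le_ereal_inf_tmp => _ [U _ <-]; apply: nneseries_ge0 => i _ _.
  by rewrite lee_fin powR_ge0.
have [d [d0 hd]] : exists d : R, 0 < d /\ (0%E < hausdorff_delta s d E)%E.
  apply: contrapT => none.
  have h0 : hausdorff_measure s E = 0%E.
    apply/eqP; rewrite eq_le; apply/andP; split.
      apply: ge_ereal_sup => _ [d /= d0 <-]; rewrite leNgt; apply/negP => hd.
      by apply: none; exists d.
    apply: (le_trans (hd0 1)); apply: ereal_sup_ubound.
    by exists 1 => //=.
  move: dimE; rewrite ltNge => /negP; apply.
  by apply: ereal_inf_lbound; exists s.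
have [e [e0 ehd]] : exists e : R, 0 < e /\ (e%:E <= hausdorff_delta s d E)%E.
  move: hd; case: (hausdorff_delta s d E) => [x|_|//].
    by rewrite lte_fin => x0; exists x.
  by exists 1; rewrite leey.
exists d, e; split=> // X cov U r rd rU cE.
pose V i := nth set0 (map U cov) i.
have Vbig i : (size cov <= i)%N -> V i = set0.
  by move=> le; rewrite /V nth_default // size_map.
have Vd c : c \in cov -> (diam (U c) <= (r c)%:E)%E.
  by move=> cc; apply: diam_le => p q; exact: rU.
have cover : (hausdorff_delta s d E <= \sum_(0 <= i <oo) ((fine (diam (V i))) `^ s)%:E)%E.
  apply: ereal_inf_lbound; exists V => //; split=> [i|p Ep].
    have [le|lt] := leqP (size cov) i; first by rewrite Vbig // diam0 leNye.
    have [c cc ->] : exists2 c, c \in cov & V i = U c.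
      case: (cov) lt @V {Vbig} => // c0 cov' lt.
      by exists (nth c0 (c0 :: cov') i); [exact: mem_nth | rewrite (nth_map c0)].
    by apply: (le_trans (Vd c cc)); rewrite lee_fin; have /andP[] := rd c cc.
  have [c cc Uc] := cE p Ep; exists (index c cov) => //.
  by rewrite /V (nth_map c) ?index_mem // nth_index.
have := le_trans ehd cover.
rewrite (nneseries_split 0 (size cov)); last by move=> k _; rewrite lee_fin powR_ge0.
rewrite (eseries0 (N := (0 + size cov)%N)) ?adde0; last first.
  by move=> i le _; rewrite Vbig // diam0 /= powR0 // gt_eqF.
rewrite sumEFin lee_fin => /le_trans; apply.
rewrite add0n; case E0 : cov => [|c0 cov']; first by rewrite !big_nil.
rewrite -E0 (big_nth c0) !big_nat; apply: ler_sum => i /andP[_ ic].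
have cc : nth c0 cov i \in cov by rewrite mem_nth.
have /andP[r0 _] := rd _ cc.
rewrite /V (nth_map c0) //.
have /andP[f0 fr] := fine_diam r0 (Vd _ cc).
by apply: ge0_ler_powR; rewrite ?nnegrE // ltW.
Qed.

End Hausdorff.

Section Frostman.
Variables (R : realType) (L : R) (E : set (R * R)).
Hypothesis L0 : 0 < L.
Hypothesis EL : forall p, E p -> `|p.1| < L /\ `|p.2| < L.

(** Rescales [-L, L) to [0, 1), so that all of E lies in a single square of level 0, the root of the
    tree. *)
Definition ucoord (x : R) : R := (x + L) / (2 * L).
Definition sqidx (l : nat) (p : R * R) : int * int :=
  (Num.floor (16 ^+ l * ucoord p.1), Num.floor (16 ^+ l * ucoord p.2)).
Definition subsq (i : int * int) : seq (int * int) :=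
  undup [seq (16 * i.1 + Posz x, 16 * i.2 + Posz y) | x <- iota 0 16, y <- iota 0 16].

Lemma floor16 (t : R) (a : int) :
  (exists2 x : nat, (x < 16)%N & Num.floor (16 * t) = 16 * a + Posz x) <-> Num.floor t = a.
Proof.
split=> [[x x16 ft]|<-].
  apply: Num.Theory.floor_def; have /andP[f1 f2] := Num.Theory.floor_itv (16 * t).
  have x16' : x%:R + 1 <= 16 :> R by rewrite natr1 ler_nat.
  have x0 : 0 <= x%:R :> R by [].
  move: f1 f2; rewrite ft !intrD !intrM => f1 f2.
  by apply/andP; split; lra.
have h1 : (16 * Num.floor t <= Num.floor (16 * t)).
  by rewrite Num.Theory.floor_ge_int intrM; have := Num.Theory.floor_le t; lra.
have h2 : (Num.floor (16 * t) < 16 * Num.floor t + 16).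
  by rewrite Num.Theory.floor_lt_int intrD intrM; have := Num.Theory.floorD1_gt t; rewrite intrD; lra.
by exists `|(Num.floor (16 * t) - 16 * Num.floor t)%R|%N; lia.
Qed.

Lemma subsqP l p i : (sqidx l.+1 p \in subsq i) = (sqidx l p == i).
Proof.
have e x : 16 ^+ l.+1 * ucoord x = 16 * (16 ^+ l * ucoord x) by rewrite exprS mulrA.
rewrite mem_undup /sqidx !e; apply/allpairsP/eqP => [[[x y] [xi yi [h1 h2]]]|<-].
  rewrite [i]surjective_pairing; congr pair; apply/floor16.
    by exists x => //; move: xi; rewrite mem_iota.
  by exists y => //; move: yi; rewrite mem_iota.
have /floor16[x x16 ->] : Num.floor (16 ^+ l * ucoord p.1) = Num.floor (16 ^+ l * ucoord p.1) by [].
have /floor16[y y16 ->] : Num.floor (16 ^+ l * ucoord p.2) = Num.floor (16 ^+ l * ucoord p.2) by [].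
by exists (x, y); rewrite !mem_iota.
Qed.

Lemma sqidx0 p : E p -> sqidx 0 p = (0, 0).
Proof.
move=> /EL; rewrite !ltr_norml => -[/andP[p1 p1'] /andP[p2 p2']].
have h x : - L < x -> x < L -> Num.floor (16 ^+ 0 * ucoord x) = 0.
  move=> x1 x2; apply: Num.Theory.floor_def; rewrite expr0 mul1r /ucoord.
  have L2 : 0 < 2 * L by move: L0; lra.
  by rewrite ler_pdivlMr // ltr_pdivrMr // add0r; apply/andP; split; move: L0; lra.
by rewrite /sqidx !h.
Qed.

Lemma sqidx_close l p q : sqidx l p = sqidx l q ->
  `|p.1 - q.1| <= 2 * L * (16^-1) ^+ l /\ `|p.2 - q.2| <= 2 * L * (16^-1) ^+ l.
Proof.
have h x y : Num.floor (16 ^+ l * ucoord x) = Num.floor (16 ^+ l * ucoord y) ->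
    `|x - y| <= 2 * L * (16^-1) ^+ l.
  move=> fxy.
  have /andP[x1 x2] := Num.Theory.floor_itv (16 ^+ l * ucoord x).
  have /andP[y1 y2] := Num.Theory.floor_itv (16 ^+ l * ucoord y).
  move: x1 x2 y1 y2; rewrite fxy !intrD; set f := (Num.floor _)%:~R => x1 x2 y1 y2.
  have L2 : 0 < 2 * L by move: L0; lra.
  have c : `|16 ^+ l * ucoord x - 16 ^+ l * ucoord y| <= 1 by rewrite ler_norml; apply/andP; split; lra.
  have p16 : 0 < (16 : R) ^+ l by rewrite exprn_gt0.
  have e : 16 ^+ l * ucoord x - 16 ^+ l * ucoord y = 16 ^+ l / (2 * L) * (x - y).
    by rewrite /ucoord; field; rewrite gt_eqF.
  move: c; rewrite e normrM ger0_norm; last by rewrite divr_ge0 // ltW.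
  by rewrite mulrC mulrA ler_pdivrMr // mul1r exprVn ler_pdivlMr.
by move=> [/h h1 /h h2].
Qed.

Lemma sqidx_edist l p q : sqidx l p = sqidx l q -> edist p q <= 4 * L * (16^-1) ^+ l.
Proof.
move=> /sqidx_close[h1 h2].
have e0 : 0 <= 4 * L * (16^-1) ^+ l :> R by rewrite !mulr_ge0 // ?exprn_ge0 ?invr_ge0 // ltW.
rewrite -[X in _ <= X](ger0_norm e0) -sqrtr_sqr /edist; apply: ler_wsqrtr.
rewrite -(real_normK (num_real (p.1 - q.1))) -(real_normK (num_real (p.2 - q.2))).
have n1 := normr_ge0 (p.1 - q.1); have n2 := normr_ge0 (p.2 - q.2).
set u := 2 * L * (16^-1) ^+ l in h1 h2 *.
have -> : 4 * L * (16^-1) ^+ l = 2 * u by rewrite /u; ring.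
by nra.
Qed.

Hypothesis dimE : ((7 / 4 : R)%:E < hausdorff_dim E)%E.

(* Base 16 is used throughout because 16 ^ (7 / 4) = 128 is an integer. *)
Lemma powR_16 (l : nat) : ((16^-1 : R) ^+ l) `^ (7 / 4) = (128^-1) ^+ l.
Proof.
have -> : (16^-1 : R) ^+ l = (2^-1) `^ (4 * l%:R).
  by rewrite -natrM powR_mulrn ?invr_ge0 // exprM; congr (_ ^+ _); field.
rewrite -powRrM (_ : 4 * l%:R * (7 / 4) = (7 * l)%:R); last by rewrite natrM; field.
by rewrite powR_mulrn ?invr_ge0 // exprM; congr (_ ^+ _); field.
Qed.

(** The cut is a cover of E by squares. If one of them is coarse, its capacity alone bounds the mass
    below; otherwise all are small enough for the Hausdorff lower bound. Either way the bound does
    not depend on the depth n. *)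
Lemma frostman_tree : exists2 c : R, 0 < c & forall n, exists S : seq (R * (R * R)),
  [/\ forall z, z \in S -> 0 <= z.1 /\ E z.2,
      forall m j, (m <= n)%N -> mass S (fun p => sqidx m p == j) <= (128^-1) ^+ m &
      c <= \sum_(z <- S) z.1].
Proof.
have s0 : 0 < 7 / 4 :> R by lra.
have [d [e [d0 e0 hd]]] := hausdorff_pos s0 dimE.
have L4 : 0 < 4 * L by rewrite mulr_gt0.
have [l0 l0P] : exists l0 : nat, 4 * L * (16^-1) ^+ l0 <= d.
  exists (Num.truncn (4 * L / d)).+1; set k := (Num.truncn _).+1.
  have k16 : k%:R <= (16 : R) ^+ k.
    by rewrite -natrX ler_nat; apply/ltnW/ltn_expl.
  have kd : 4 * L / d < k%:R by apply: truncnS_gt.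
  rewrite exprVn ler_pdivrMr ?exprn_gt0 // [d * _]mulrC -ler_pdivrMr //.
  exact: (le_trans (ltW kd)).
pose K : R := (4 * L) `^ (7 / 4).
have K0 : 0 < K by rewrite powR_gt0.
pose c : R := Num.min ((128^-1) ^+ l0) (e / K).
exists c; first by rewrite lt_min exprn_gt0 ?invr_gt0 // divr_gt0.
move=> n.
have cap0 l : 0 < (128^-1 : R) ^+ l by rewrite exprn_gt0 // invr_gt0.
have [S [cov [SE Scap Scov Stot]]] :=
  @tree_measure_exists R (R * R)%type (int * int)%type E sqidx subsq (fun l => (128^-1) ^+ l)
    (fun i => undup_uniq _) subsqP cap0 n 0%N (0, 0).
exists S; split.
- by move=> z /SE[].
- by move=> m j mn; apply: Scap; rewrite add0n.
apply: le_trans Stot.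
have [/hasP[c0 c0c lt]|/hasPn big] := boolP (has (fun c => (c.1 < l0)%N) cov).
  apply: (@le_trans _ _ ((128^-1) ^+ l0)); first by rewrite ge_min lexx.
  rewrite (perm_big _ (perm_to_rem c0c)) big_cons /=.
  apply: (@le_trans _ _ ((128^-1) ^+ c0.1)).
    by apply: ler_wiXn2l; [rewrite invr_ge0 | rewrite invf_le1 //; lra | exact: ltnW].
  by rewrite lerDl; apply: sumr_ge0 => *; apply: ltW.
apply: (@le_trans _ _ (e / K)); first by rewrite ge_min lexx orbT.
rewrite ler_pdivrMr // mulrC big_distrr /=.
have := hd _ cov (fun c => [set p | sqidx c.1 p = c.2]) (fun c => 4 * L * (16^-1) ^+ c.1).
have -> : \sum_(c1 <- cov) (4 * L * 16^-1 ^+ c1.1) `^ (7 / 4) = \sum_(i <- cov) K * 128^-1 ^+ i.1.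
  by apply: eq_bigr => c1 _; rewrite powRM ?powR_16 //; exact: ltW.
apply.
- move=> c1 c1c; apply/andP; split.
    by rewrite mulr_ge0 ?(ltW L4) // exprn_ge0 // invr_ge0.
  apply: le_trans l0P; rewrite ler_pM2l //.
  apply: ler_wiXn2l; [by rewrite invr_ge0 | by rewrite invf_le1 //; lra | ].
  by have := big _ c1c; rewrite -leqNgt.
- by move=> c1 p q _ /= pc qc; apply: sqidx_edist; rewrite pc qc.
- by move=> p Ep; apply: Scov => //; exact: sqidx0.
Qed.

Lemma frostman : exists S : nat -> seq (R * (R * R)),
  [/\ forall n z, z \in S n -> 0 <= z.1 /\ E z.2,
      forall n, \sum_(z <- S n) z.1 = 1 &
      forall A : R, 0 <= A -> exists2 C : R, 0 <= C & forall n l q, (l <= n)%N ->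
        \sum_(z <- S n | box (A * (16^-1) ^+ l) q z.2) z.1 <= C * (128^-1) ^+ l].
Proof.
have [c c0 /choice[F FP]] := frostman_tree.
pose t n := \sum_(z <- F n) z.1.
have t0 n : 0 < t n by have [_ _] := FP n; exact: lt_le_trans.
pose S n := [seq ((t n)^-1 * z.1, z.2) | z <- F n].
have S0 n z : z \in S n -> 0 <= z.1 /\ E z.2.
  move=> /mapP[y yF ->] /=; have [/(_ y yF)[y0 yE] _ _] := FP n.
  by split=> //; rewrite mulr_ge0 // invr_ge0 ltW.
have S1 n : \sum_(z <- S n) z.1 = 1.
  by rewrite big_map -big_distrr /= mulVf // gt_eqF.
exists S; split=> // A A0.
have L2 : 0 < 2 * L by rewrite mulr_gt0.
(* With this [a], a box of half-side A 16^-l is at most one cell wide at level l - a, hence meets at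
   most two cells per axis. *)
have [a aP] : exists a : nat, A / (2 * L) * 2 <= 16 ^+ a.
  exists (Num.truncn (A / (2 * L) * 2)).+1; set k := (Num.truncn _).+1.
  have k16 : k%:R <= (16 : R) ^+ k by rewrite -natrX ler_nat; apply/ltnW/ltn_expl.
  by apply: le_trans k16; apply/ltW/truncnS_gt.
pose C : R := 128 ^+ a * (1 + 4 / c).
have C0 : 0 <= C by rewrite mulr_ge0 ?exprn_ge0 // addr_ge0 // divr_ge0 // ltW.
exists C => // n l q ln.
have total : \sum_(z <- S n | box (A * (16^-1) ^+ l) q z.2) z.1 <= 1.
  by rewrite -(S1 n); apply: (@mass_le_total R (R * R)%type (S n)) => z /S0[].
have c4 : 0 <= 4 / c by rewrite divr_ge0 // ltW.
(* For l < a there is no level l - a, but then the total mass 1 is already within the bound. *)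
have [la|al] := ltnP l a.
  apply: (le_trans total); rewrite /C mulrAC.
  have : 1 <= 128 ^+ a * (128^-1 : R) ^+ l.
    rewrite exprVn ler_pdivlMr ?exprn_gt0 // mul1r ler_eXn2l //; [exact: ltnW | lra].
  by nra.
pose m := (l - a)%N.
have mn : (m <= n)%N by apply: leq_trans ln; exact: leq_subr.
(* The shift by 1 / 2 selects the cell of the left end of the unit interval centred at the rescaled
   x. *)
pose w (x : R) : int := Num.floor (16 ^+ m * ucoord x - 2^-1).
have win x y : `|y - x| <= A * (16^-1) ^+ l ->
    Num.floor (16 ^+ m * ucoord y) = w x \/ Num.floor (16 ^+ m * ucoord y) = w x + 1.
  move=> xy.
  have close : `|16 ^+ m * ucoord y - 16 ^+ m * ucoord x| <= 2^-1.
    have -> : 16 ^+ m * ucoord y - 16 ^+ m * ucoord x = 16 ^+ m / (2 * L) * (y - x).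
      by rewrite /ucoord; field; rewrite gt_eqF.
    rewrite normrM ger0_norm; last by rewrite divr_ge0 ?exprn_ge0 // ltW.
    apply: (@le_trans _ _ (16 ^+ m / (2 * L) * (A * (16^-1) ^+ l))).
      by apply: ler_wpM2l => //; rewrite divr_ge0 ?exprn_ge0 // ltW.
    have -> : (16^-1 : R) ^+ l = (16 ^+ m)^-1 * (16 ^+ a)^-1.
      by rewrite -invfM -exprD exprVn /m subnK.
    have -> : 16 ^+ m / (2 * L) * (A * ((16 ^+ m)^-1 / 16 ^+ a)) = A / (2 * L) / 16 ^+ a.
      by field; rewrite !expf_neq0 //; rewrite gt_eqF.
    by rewrite ler_pdivrMr ?exprn_gt0 //; lra.
  have /andP[w1 w2] := Num.Theory.floor_itv (16 ^+ m * ucoord x - 2^-1).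
  move: close w1 w2; rewrite -/(w x) ler_norml intrD => /andP[k1 k2] w1 w2.
  have [small|big] := ltP (16 ^+ m * ucoord y) (w x + 1)%:~R; [left|right];
    apply: Num.Theory.floor_def; move: small || move: big; rewrite ?small ?big !intrD => h;
    apply/andP; split; lra.
pose idxs := [:: (w q.1, w q.2); (w q.1, w q.2 + 1); (w q.1 + 1, w q.2); (w q.1 + 1, w q.2 + 1)].
have sub : \sum_(z <- S n | box (A * (16^-1) ^+ l) q z.2) z.1 <=
    \sum_(j <- idxs) mass (S n) (fun p => sqidx m p == j).
  rewrite /mass big_mkcond /=; under [X in _ <= X]eq_bigr do rewrite big_mkcond /=.
  rewrite [X in _ <= X]exchange_big /= big_seq [X in _ <= X]big_seq.
  apply: ler_sum => z /S0[z0 _].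
  have s0 (r : seq (int * int)) : 0 <= \sum_(j <- r) if sqidx m z.2 == j then z.1 else 0.
    by apply: sumr_ge0 => j _; case: ifP.
  case: ifP => // /andP[/win b1 /win b2].
  have zi : sqidx m z.2 \in idxs.
    by rewrite /sqidx /idxs !inE; case: b1 => ->; case: b2 => ->; rewrite eqxx ?orbT.
  by rewrite (perm_big _ (perm_to_rem zi)) big_cons eqxx lerDl.
apply: (le_trans sub).
have capj j : mass (S n) (fun p => sqidx m p == j) <= c^-1 * (128 ^+ a * (128^-1) ^+ l).
  have -> : 128 ^+ a * (128^-1 : R) ^+ l = (128^-1) ^+ m.
    by rewrite -(subnK al) exprD -/m mulrCA [(128^-1) ^+ a]exprVn mulfV ?mulr1 //.
  have [_ /(_ m j mn) Fc Ft] := FP n.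
  have -> : mass (S n) (fun p => sqidx m p == j) = (t n)^-1 * mass (F n) (fun p => sqidx m p == j).
    by rewrite /mass big_map /= big_distrr.
  have m0 : 0 <= mass (F n) (fun p => sqidx m p == j).
    rewrite /mass big_seq_cond; apply: sumr_ge0 => z /andP[zF _].
    by have [/(_ z zF)[]] := FP n.
  by apply: ler_pM => //; rewrite ?invr_ge0 ?(ltW (t0 n)) // lef_pV2 ?posrE.
apply: (@le_trans _ _ (\sum_(j <- idxs) c^-1 * (128 ^+ a * (128^-1) ^+ l))).
  by apply: ler_sum => j _; exact: capj.
rewrite /idxs !big_cons big_nil addr0 /C.
have e0 : 0 <= 128 ^+ a * (128^-1 : R) ^+ l by rewrite mulr_ge0 ?exprn_ge0 // invr_ge0.
have ee : 128 ^+ a * (1 + 4 / c) * 128^-1 ^+ l = 128 ^+ a * 128^-1 ^+ l + 4 * (c^-1 * (128 ^+ a * 128^-1 ^+ l)) by ring.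
rewrite ee; set X := c^-1 * _; lra.
Qed.

End Frostman.

(** * Proof of the theorem *)

Section Continuity.
Variables (R : realType) (T : topologicalType).
Implicit Types f g : T -> R * R.

Lemma continuous_det2 f g : continuous f -> continuous g ->
  continuous (fun t => det2 (f t) (g t)).
Proof.
move=> cf cg t.
have c1 h : continuous h -> (fun t : T => (h t : R * R).1) @ t --> (h t).1.
  by move=> ch; apply: (cvg_comp _ _ (ch t)); exact: cvg_fst.
have c2 h : continuous h -> (fun t : T => (h t : R * R).2) @ t --> (h t).2.
  by move=> ch; apply: (cvg_comp _ _ (ch t)); exact: cvg_snd.
by apply: cvgB; apply: cvgM; [exact: c1 | exact: c2 | exact: c2 | exact: c1].
Qed.

Lemma continuous_vsub f w : continuous f -> continuous (fun t => vsub (f t) w).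
Proof.
move=> cf t.
have c1 : (fun t : T => (f t).1) @ t --> (f t).1.
  by apply: (cvg_comp _ _ (cf t)); exact: cvg_fst.
have c2 : (fun t : T => (f t).2) @ t --> (f t).2.
  by apply: (cvg_comp _ _ (cf t)); exact: cvg_snd.
exact: (cvg_pair (cvgB c1 (cvg_cst w.1)) (cvgB c2 (cvg_cst w.2))).
Qed.

End Continuity.

Lemma compact_coord_bound (R : realType) (E : set (R * R)) : compact E ->
  exists2 L : R, 0 < L & forall p, E p -> `|p.1| < L /\ `|p.2| < L.
Proof.
move=> /(@compact_bounded R (R^o * R^o)%type) /ex_strict_bound_gt0[L L0 EL].
exists L => // p /EL /=; rewrite /Num.norm /= gt_max => /andP[-> ->].
by [].
Qed.

(** Both components have the middle point as second argument, as in the correlation of two densities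
    at the same y; the sign against [area_pairs] disappears in the absolute value. *)
Definition det_pairs (R : realType) (w : R * R) (p : (R * R) * (R * R) * (R * R)) : R * R :=
  (det2 (vsub p.1.1 w) (vsub p.1.2 w), det2 (vsub p.2 w) (vsub p.1.2 w)).

Lemma det_pairs_closed (R : realType) (w : R * R) (E : set (R * R)) : compact E ->
  closed (det_pairs w @` (E `*` E `*` E)).
Proof.
move=> cE; apply: compact_closed; first exact: (@norm_hausdorff R (R^o * R^o)%type).
apply: continuous_compact; last by apply: compact_setX => //; exact: compact_setX.
apply: continuous_subspaceT.
have cx : continuous (fun p : (R * R) * (R * R) * (R * R) => vsub p.1.1 w).
  by apply: continuous_vsub => p; apply: (cvg_comp _ _ cvg_fst); exact: cvg_fst.
have cy : continuous (fun p : (R * R) * (R * R) * (R * R) => vsub p.1.2 w).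
  by apply: continuous_vsub => p; apply: (cvg_comp _ _ cvg_fst); exact: cvg_snd.
have cz : continuous (fun p : (R * R) * (R * R) * (R * R) => vsub p.2 w).
  by apply: continuous_vsub => p; exact: cvg_snd.
move=> p.
have c1 : det2 (vsub q.1.1 w) (vsub q.1.2 w) @[q --> p] --> det2 (vsub p.1.1 w) (vsub p.1.2 w).
  exact: (continuous_det2 cx cy).
have c2 : det2 (vsub q.2 w) (vsub q.1.2 w) @[q --> p] --> det2 (vsub p.2 w) (vsub p.1.2 w).
  exact: (continuous_det2 cz cy).
exact: (cvg_pair c1 c2).
Qed.

Theorem theorem1p5 (R : realType) (E : set (R * R)) :
  compact E ->
  ((7 / 4 : R)%:E < hausdorff_dim E)%E ->
  (interior (area_pairs E)) !=set0.
Proof.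
move=> cE dimE.
have [L L0 EL] := compact_coord_bound cE.
have [S [SE S1 SF]] := frostman L0 EL dimE.
(* Any point of E can serve as w; the support of a measure of mass 1 provides one. *)
have [[? w] w0S _] : exists2 z, z \in S 0%N & z.1 != 0.
  by apply: sum_neq0_exists; rewrite S1 oner_neq0.
have [_ /= Ew] := SE _ _ w0S.
pose M := 2 * L + 1.
pose S' n := [seq (z.1, vsub z.2 w) | z <- S n].
have S'P n z : z \in S' n -> exists2 p, E p & z.2 = vsub p w.
  by move=> /mapP[y /SE[_ Ey] ->]; exists y.2.
have M1 : 1 <= M by rewrite /M; lra.
have S'0 n z : z \in S' n -> 0 <= z.1 /\ `|z.2.1| <= M /\ `|z.2.2| <= M.
  move=> /mapP[y /SE[y0 Ey] ->] /=; split=> //.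
  have [y1 y2] := EL _ Ey; have [w1 w2] := EL _ Ew.
  by split; apply: (le_trans (ler_normB _ _)); rewrite /M; lra.
have S'1 n : \sum_(z <- S' n) z.1 = 1 by rewrite big_map S1.
have S'F (A : R) : 0 <= A -> exists2 C : R, 0 <= C & forall n l q, (l <= n)%N ->
    \sum_(z <- S' n | box (A * (16^-1) ^+ l) q z.2) z.1 <= C * (128^-1) ^+ l.
  move=> /SF[C C0 FC]; exists C => // n l q ln; rewrite big_map /=.
  under eq_bigl => z.
    have -> : box (A * (16^-1) ^+ l) q (vsub z.2 w) = box (A * (16^-1) ^+ l) (q.1 + w.1, q.2 + w.2) z.2.
      by rewrite /box /= ![_ + w.1]addrC ![_ + w.2]addrC !opprD !addrA.
    over.
  exact: FC.
have [s0 [r [r0 rs0 dense]]] := dense_ball M1 S'0 S'1 S'F.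
(* The determinants come arbitrarily close to (s, t), and their set is closed, being a continuous
   image of a compact set. *)
have full s t : `|s - s0| < r -> `|t - s0| < r -> (det_pairs w @` (E `*` E `*` E)) (s, t).
  move=> ss0 ts0; apply: (det_pairs_closed (w := w) cE) => B /nbhs_ballP[e /= e0 eB].
  have [n [x [y [z [/S'P[x' Ex ->] /S'P[y' Ey ->] /S'P[z' Ez ->] xs zt]]]]] := dense s t e ss0 ts0 e0.
  exists (det_pairs w (x', y', z')); split; first by exists (x', y', z').
  by apply: eB; split; rewrite /= /ball /= distrC.
pose u := `|s0|.
(* Halves account for the factor 1 / 2 in an area; r <= |s0| / 2 keeps both coordinates positive on
   the ball. *)
exists (u / 2, u / 2); apply/nbhs_ballP; exists (r / 2) => /=; first by rewrite divr_gt0.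
move=> [a b] [/=]; rewrite /ball /= => ha hb.
(* Areas forget signs: the pair (a, b) is reached from determinants 2 a and 2 b carrying the sign of
   [s0]. *)
pose sg : R := if 0 <= s0 then 1 else -1.
have sgK : sg * u = s0.
  by rewrite /sg /u; case: (ger0P s0) => _; rewrite ?mul1r // mulN1r opprK.
have nsg x : `|sg * x| = `|x|.
  by rewrite normrM /sg; case: ifP; rewrite ?normrN normr1 mul1r.
have pos x : `|u / 2 - x| < r / 2 -> 0 < x.
  by rewrite ltr_norml => /andP[? ?]; move: rs0; rewrite -/u; lra.
have close x : `|u / 2 - x| < r / 2 -> `|sg * (2 * x) - s0| < r.
  move=> hx; rewrite -sgK -mulrBr nsg.
  by move: hx; rewrite !ltr_norml => /andP[? ?]; apply/andP; split; lra.
have [[[x y] z] [[/= Ex Ey] Ez] [dx dz]] := full _ _ (close a ha) (close b hb).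
have half c : 0 < c -> 2^-1 * `|sg * (2 * c)| = c.
  by move=> c0; rewrite nsg gtr0_norm ?mulr_gt0 // mulrA mulVf ?mul1r.
exists x, y, z, w; split=> //; congr pair.
  by rewrite dx half // pos.
have -> : det2 (vsub y w) (vsub z w) = - det2 (vsub z w) (vsub y w) by rewrite /det2; ring.
by rewrite normrN dz half // pos.
Qed.
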